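(* Let $\mathbb{M}$ be a compact two-point homogeneous manifold. Let $N\subset\mathbb{Z}_+$ be an infinite set and let $A_k\subset\{1,\ldots,m_k\}$, $k\in N$, be such that $$\lim_{k\to\infty,\ k\in N}\ \frac{c_k^{-1}\sum_{j\in A_k^c}f_{j,k}(\xi)\overline{f_{j,k}(\zeta)}}{P_k^{(\alpha,\beta)}(1)}=0\qquad\text{for all }\xi,\zeta\in\mathbb{M},$$ where $A_k^c:=\{1,\ldots,m_k\}\setminus A_k$. If $\mathbb{M}\neq\mathbb{S}^{d-1}$, then $\mathcal{F}:=\{(j,k): k\in N,\ j\in A_k\}$ induces strict positive definiteness. If $\mathbb{M}=\mathbb{S}^{d-1}$, then the same conclusion holds under the additional requirement that both $N\cap 2\mathbb{Z}_+$ and $N\cap(2\mathbb{Z}_++1)$ are infinite.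
   Context: $\mathbb{Z}_+=\{0,1,2,\ldots\}$. The compact two-point homogeneous manifolds $\mathbb{M}$ considered are (superscripts denote real dimension): the sphere $\mathbb{S}^{d-1}$ with $d\ge 3$; the real projective spaces $P^{d-1}(\mathbb{R})$, $d-1=2,3,\ldots$; the complex projective spaces $P^{d-1}(\mathbb{C})$, $d-1=4,6,8,\ldots$; the quaternionic projective spaces $P^{d-1}(H)$, $d-1=8,12,16,\ldots$; the Cayley projective plane $P^{16}(Cay)$ ($d=17$). Set $\alpha=\frac{d-3}{2}$, and let $\beta=\frac{d-3}{2},\,-\frac12,\,0,\,1,\,3$, respectively, in the order of these five cases. Let $d(\xi,\zeta)$ be the geodesic distance on $\mathbb{M}$ normalized so that $\mathbb{M}$ has diameter $\pi$ (for the sphere $d(\xi,\zeta)=\arccos\langle\xi,\zeta\rangle$; for the projective spaces $d(\xi,\zeta)=2\arccos|\langle\tilde\xi/|\tilde\xi|,\tilde\zeta/|\tilde\zeta|\rangle|$ with $\tilde\xi,\tilde\zeta$ class representatives). Fix an orthonormal basis $\{f_{j,k}:k\in\mathbb{Z}_+,\ 1\le j\le m_k\}$ of $L^2(\mathbb{M})$ (invariant measure normalized to total mass $1$) of smooth eigenfunctions of the Laplace-Beltrami operator, where $f_{1,k},\ldots,f_{m_k,k}$ is a basis of the $m_k$-dimensional eigenspace belonging to the $k$-th distinct eigenvalue (in increasing order, with eigenvalue $0$ for $k=0$). The addition formula holds: $$\sum_{j=1}^{m_k}f_{j,k}(\xi)\overline{f_{j,k}(\zeta)}=c_kP_k^{(\alpha,\beta)}(\cos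 d(\xi,\zeta)),\qquad c_k=\frac{\Gamma(\beta+1)(2k+\alpha+\beta+1)\Gamma(k+\alpha+\beta+1)}{\Gamma(\alpha+\beta+2)\Gamma(k+\beta+1)},$$ where $P_k^{(\alpha,\beta)}$ is the Jacobi polynomial normalized by $P_k^{(\alpha,\beta)}(1)=\frac{\Gamma(k+\alpha+1)}{\Gamma(k+1)\Gamma(\alpha+1)}$. A Hermitian kernel $K:\mathbb{M}\times\mathbb{M}\to\mathbb{C}$ is positive definite if for every finite set $\Xi\subset\mathbb{M}$ of distinct points the matrix $(K(\xi,\zeta))_{\xi,\zeta\in\Xi}$ is positive semi-definite, and strictly positive definite if this matrix is positive definite for every such $\Xi$. A set $\mathcal{F}$ of index pairs $(j,k)$ induces strict positive definiteness if every continuous positive definite kernel of the form $K(\xi,\zeta)=\sum_{k=0}^\infty\sum_{j=1}^{m_k}d_{j,k}f_{j,k}(\xi)\overline{f_{j,k}(\zeta)}$ (pointwise convergent, $d_{j,k}\ge 0$) with $\{(j,k):d_{j,k}>0\}=\mathcal{F}$ is strictly positive definite. *)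

(* Defs.v *)
From HB Require Import structures.
From mathcomp Require Import all_boot all_order all_algebra.
From mathcomp Require Import all_classical all_reals all_analysis.
From mathcomp Require Import complex.
Import Order.TTheory GRing.Theory Num.Theory.
Import numFieldNormedType.Exports.
Local Open Scope classical_set_scope.
Local Open Scope ring_scope.
Local Open Scope complex_scope.

Set Implicit Arguments.
Unset Strict Implicit.
Unset Printing Implicit Defensive.

(* Elements of the m-th algebra (m = 0, 1, 2, 3 for R, C, H, O) are coordinate
   row vectors of length 2 ^ m, a pair (a, b) being [row_mx a b], with
   (a, b)(c, d) = (ac - d^* b, da + b c^* ) and (a, b)^* = (a^*, - b).
   [cd_dim] is a fixpoint, and not [2 ^ m], so that [lsubmx] and [rsubmx]
   apply without a cast. *)
Fixpoint cd_dim (m : nat) : nat :=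
  if m is m'.+1 then (cd_dim m' + cd_dim m')%N else 1%N.

Section CayleyDickson.
Variable R : realType.

Fixpoint cd_conj (m : nat) : 'rV[R]_(cd_dim m) -> 'rV[R]_(cd_dim m) :=
  match m with
  | 0%N => fun x => x
  | m'.+1 => fun x : 'rV[R]_(cd_dim m' + cd_dim m') =>
      row_mx (cd_conj (lsubmx x)) (- rsubmx x)
  end.

Fixpoint cd_mul (m : nat) :
    'rV[R]_(cd_dim m) -> 'rV[R]_(cd_dim m) -> 'rV[R]_(cd_dim m) :=
  match m with
  | 0%N => fun x y => x *m y
  | m'.+1 => fun x y : 'rV[R]_(cd_dim m' + cd_dim m') =>
      let a := lsubmx x in let b := rsubmx x in
      let c := lsubmx y in let d := rsubmx y in
      row_mx (cd_mul a c - cd_mul (cd_conj d) b)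
             (cd_mul d a + cd_mul b (cd_conj c))
  end.

Fixpoint cd_re (m : nat) : 'rV[R]_(cd_dim m) -> R :=
  match m with
  | 0%N => fun x => x 0 0
  | m'.+1 => fun x : 'rV[R]_(cd_dim m' + cd_dim m') => cd_re (lsubmx x)
  end.

Fixpoint cd_one (m : nat) : 'rV[R]_(cd_dim m) :=
  match m with
  | 0%N => 1%:M
  | m'.+1 => row_mx (cd_one m') 0
  end.

Lemma cd_conj0 m : cd_conj (0 : 'rV[R]_(cd_dim m)) = 0.
Proof.
elim: m => [//|m IH] /=.
by rewrite linear0 IH linear0 oppr0 row_mx0.
Qed.

Lemma cd_conj1 m : cd_conj (cd_one m) = cd_one m.
Proof. by elim: m => [//|m IH] /=; rewrite row_mxKl row_mxKr IH oppr0. Qed.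

Lemma cd_mul0l m (x : 'rV[R]_(cd_dim m)) :
  cd_mul 0 x = 0 /\ cd_mul x 0 = 0.
Proof.
elim: m x => [|m IH] x /=; first by rewrite mul0mx mulmx0.
rewrite !linear0 cd_conj0 !(proj1 (IH _)) !(proj2 (IH _)).
by rewrite subr0 addr0 row_mx0.
Qed.

Lemma cd_mul11 m : cd_mul (cd_one m) (cd_one m) = cd_one m.
Proof.
elim: m => [|m IH] /=; first by rewrite mul1mx.
rewrite !row_mxKl !row_mxKr IH cd_conj0.
by rewrite !(proj1 (cd_mul0l _)) addr0 subr0.
Qed.

Lemma cd_re0 m : cd_re (0 : 'rV[R]_(cd_dim m)) = 0.
Proof. by elim: m => [|m IH] /=; rewrite ?mxE // linear0. Qed.

Lemma cd_re1 m : cd_re (cd_one m) = 1.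
Proof. by elim: m => [|m IH] /=; rewrite ?mxE // row_mxKl. Qed.

Lemma cd_dim_gt0 m : (0 < cd_dim m)%N.
Proof. by elim: m => [//|m IH] /=; rewrite addn_gt0 IH. Qed.

End CayleyDickson.

Arguments cd_conj : simpl never.
Arguments cd_mul : simpl never.
Arguments cd_re : simpl never.
Arguments cd_one : simpl never.

Variant division_ring := RealNumbers | ComplexNumbers | Quaternions.

Definition level (K : division_ring) : nat :=
  match K with RealNumbers => 0 | ComplexNumbers => 1 | Quaternions => 2 end.

(* [Sphere d] is the unit sphere of R^d; [Projective K n] is the space of lines
   of K^(n+1), of real dimension n, 2n, 4n according to K. *)
Inductive two_point_space :=
  | Sphere (d : nat) of (3 <= d)%N
  | Projective (K : division_ring) (n : nat) of (2 <= n)%N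
  | CayleyPlane.

Definition is_sphere (M : two_point_space) : bool :=
  if M is Sphere _ _ then true else false.

(* the number called d in the superscripts d - 1 *)
Definition mfd_d (M : two_point_space) : nat :=
  match M with
  | Sphere d _ => d
  | Projective K n _ => (n * cd_dim (level K)).+1
  | CayleyPlane => 17
  end.

Definition mfd_dim (M : two_point_space) : nat := (mfd_d M).-1.

Section Spaces.
Variable R : realType.

Definition enorm p q (x : 'M[R]_(p, q)) : R :=
  Num.sqrt (\sum_i \sum_j x i j ^+ 2).

Definition dotv d (x y : 'rV[R]_d) : R := \sum_i x 0 i * y 0 i.

(* A vector of K^p is a p-row matrix, whose i-th row is the i-th entry.  The
   scalars act on the right. *)
Definition kvec (K : division_ring) (p : nat) := 'M[R]_(p, cd_dim (level K)).

Definition kscale K p (v : kvec K p) (a : 'rV[R]_(cd_dim (level K))) :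
    kvec K p :=
  \matrix_(i, j) cd_mul (row i v) a 0 j.

Definition kdot K p (v w : kvec K p) : 'rV[R]_(cd_dim (level K)) :=
  \sum_i cd_mul (cd_conj (row i v)) (row i w).

Definition kline K p (v : kvec K p) : set (kvec K p) :=
  [set w | exists a, w = kscale v a].

(* A 3 x 3 octonionic matrix is a 9-row matrix, whose row [mxvec_index i j] is
   the (i, j) entry. *)
Definition omat := 'M[R]_(3 * 3, cd_dim 3).

Definition oentry (X : omat) (i j : 'I_3) : 'rV[R]_(cd_dim 3) :=
  row (mxvec_index i j) X.

(* The Cayley plane is the set of Hermitian octonionic 3 x 3 matrices X with
   X ^ 2 = X and tr X = 1 (the "projections onto lines"). *)
Definition oprojection (X : omat) : Prop :=
  [/\ forall i j, oentry X j i = cd_conj (oentry X i j),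
      forall i j, \sum_k cd_mul (oentry X i k) (oentry X k j) = oentry X i j
    & \sum_i cd_re (oentry X i i) = 1].

(* Re tr (XY), which for orthogonal projections of rank one onto lines spanned
   by unit vectors v, w over R, C, H is |<v, w>| ^ 2 *)
Definition otrace (X Y : omat) : R :=
  \sum_i \sum_j cd_re (cd_mul (oentry X i j) (oentry Y j i)).

Definition mfd (M : two_point_space) : Type :=
  match M with
  | Sphere d _ => {v : 'rV[R]_d | dotv v v = 1}
  | Projective K n _ =>
      {L : set (kvec K n.+1) | exists v, v != 0 /\ L = kline v}
  | CayleyPlane => {X : omat | oprojection X}
  end.

Lemma mfd_inhabited M : exists x : mfd M, True.
Proof.
case: M => [d d3|K n n2|] /=.
- have d0 : (0 < d)%N by apply: leq_trans d3.
  unshelve eexists; [exists (delta_mx 0 (Ordinal d0))|by []].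
  rewrite /dotv (bigD1 (Ordinal d0)) //= big1 => [|i ni].
    by rewrite !mxE !eqxx mulr1 addr0.
  by rewrite !mxE (negbTE ni) andbF mul0r.
- have v0 : (const_mx 1 : kvec K n.+1) != 0.
    apply/eqP => /matrixP /(_ ord0 (Ordinal (cd_dim_gt0 (level K)))).
    by rewrite !mxE => /eqP; rewrite oner_eq0.
  by unshelve eexists; [exists (kline (const_mx 1)); exists (const_mx 1)|].
- pose e (i j : 'I_3) := if (i == 0) && (j == 0) then cd_one R 3 else 0.
  pose X : omat := \matrix_(k, l) (mxvec (\matrix_(i, j) e i j 0 l)) 0 k.
  have Xe i j : oentry X i j = e i j.
    by apply/rowP => l; rewrite /oentry !mxE mxvecE mxE.
  unshelve eexists; [exists X; split|by []].
  + move=> i j; rewrite !Xe /e andbC; case: ifP => _.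
      by rewrite cd_conj1.
    by rewrite cd_conj0.
  + move=> i j.
    rewrite (bigD1 0) // big1 => [|k nk]; rewrite /= !Xe /e.
      rewrite addr0 andbT.
      case: (i == 0); case: (j == 0); rewrite /= ?cd_mul11 //.
      - by rewrite (proj2 (cd_mul0l _)).
      - by rewrite (proj1 (cd_mul0l _)).
      - by rewrite (proj1 (cd_mul0l _)).
    by rewrite (negbTE nk) andbF (proj1 (cd_mul0l _)).
  + rewrite (bigD1 0) // big1 => [|k nk]; rewrite /= Xe /e.
      by rewrite eqxx cd_re1 addr0.
    by rewrite (negbTE nk) cd_re0.
Qed.

Definition krep K p (L : set (kvec K p)) : kvec K p :=
  xget 0 [set v | v != 0 /\ L = kline v].

(* For the Cayley plane, [otrace] plays the role of the squared modulus of the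
   scalar product of normalized representatives. *)
Definition gdist (M : two_point_space) : mfd M -> mfd M -> R :=
  match M return mfd M -> mfd M -> R with
  | Sphere d _ => fun x y => acos (dotv (sval x) (sval y))
  | Projective K n _ => fun x y =>
      let v := krep (sval x) in let w := krep (sval y) in
      2 * acos (enorm (kdot ((enorm v)^-1 *: v) ((enorm w)^-1 *: w)))
  | CayleyPlane => fun x y =>
      2 * acos (Num.sqrt (otrace (sval x) (sval y)))
  end.

End Spaces.

Section MetricTopology.
Variables (R : realType) (M : two_point_space).

HB.instance Definition _ := gen_eqMixin (mfd R M).
HB.instance Definition _ := gen_choiceMixin (mfd R M).
HB.instance Definition _ := isPointed.Build (mfd R M) (sval (cid (mfd_inhabited R M))).

Definition mfd_open : set (set (mfd R M)) :=
  [set U | forall x, U x ->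
    exists2 e : R, 0 < e & forall y, gdist x y < e -> U y].

Lemma mfd_openT : mfd_open setT.
Proof. by move=> x _; exists 1. Qed.

Lemma mfd_openI : setI_closed mfd_open.
Proof.
move=> A B oA oB x [/oA [e e0 He] /oB [e' e'0 He']].
exists (Num.min e e'); first by rewrite lt_min e0.
by move=> y; rewrite lt_min => /andP[/He ? /He' ?].
Qed.

Lemma mfd_open_bigU (I : Type) (f : I -> set (mfd R M)) :
  (forall i, mfd_open (f i)) -> mfd_open (\bigcup_i f i).
Proof.
by move=> of_ x [i _ /of_ [e e0 He]]; exists e => // y /He; exists i.
Qed.

HB.instance Definition _ := isOpenTopological.Build (mfd R M)
  mfd_openT mfd_openI mfd_open_bigU.

End MetricTopology.

Notation borel_mfd R M := (g_sigma_algebraType (@open (mfd R M))).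

Section Smoothness.
Variable R : realType.

Fixpoint is_Cn (V : normedModType R) (n : nat) (U : set V) (f : V -> R) : Prop :=
  if n is n'.+1 then
    forall v, (forall x, U x -> derivable f x v) /\ is_Cn n' U ('D_v f)
  else forall x, U x -> {for x, continuous f}.

(* for U open in a finite-dimensional V *)
Definition smooth_on (V : normedModType R) (U : set V) (f : V -> R) : Prop :=
  forall n, is_Cn n U f.

(* The sphere and the Cayley plane are compact submanifolds of Euclidean spaces,
   on which the smooth functions are the restrictions of smooth functions; the
   projective spaces over R, C, H are quotients of K^(n+1) minus 0, and their
   smooth functions are those with a smooth lift. *)
Definition mfd_smooth (M : two_point_space) : (mfd R M -> R) -> Prop :=
  match M return (mfd R M -> R) -> Prop with
  | Sphere d _ => fun f =>
      exists2 F : 'rV[R]_d -> R, smooth_on setT F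
        & forall x, f x = F (sval x)
  | Projective K n _ => fun f =>
      exists2 F : kvec R K n.+1 -> R, smooth_on [set v | v != 0] F
        & forall x v, v != 0 -> sval x = kline v -> f x = F v
  | CayleyPlane => fun f =>
      exists2 F : omat R -> R, smooth_on setT F
        & forall x, f x = F (sval x)
  end.

Variable M : two_point_space.

(* Unit speed geodesics starting at p, that is, curves which are isometric near
   the parameter 0; only their germ at 0 matters. *)
Definition geodesic_from (p : mfd R M) (g : R -> mfd R M) : Prop :=
  g 0 = p /\ exists2 e : R, 0 < e &
    forall s t, `|s| < e -> `|t| < e -> gdist (g s) (g t) = `|s - t|.

(* Unit vectors u, v are orthogonal iff |u - v| ^ 2 = 2, and
   gdist (exp (t u)) (exp (t v)) ~ t |u - v| as t -> 0. *)
Definition geodesic_frame (p : mfd R M) (g : 'I_(mfd_dim M) -> R -> mfd R M) :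
    Prop :=
  (forall i, geodesic_from p (g i)) /\
  (forall i j, i != j ->
    gdist (g i t) (g j t) ^+ 2 / t ^+ 2 @[t --> 0^'+] --> (2 : R)).

(* The value at p of the Laplace-Beltrami operator on a smooth function f is the
   sum of the second derivatives of f along the geodesics of any orthonormal
   frame at p (the trace of the Hessian). *)
Definition laplacian_at (f : mfd R M -> R) (p : mfd R M) (l : R) : Prop :=
  forall g, geodesic_frame p g -> \sum_i derive1n 2 (f \o g i) 0 = l.

Definition smooth_eigenfunction (lam : R) (f : mfd R M -> R[i]) : Prop :=
  [/\ mfd_smooth (@complex.Re R \o f), mfd_smooth (@complex.Im R \o f)
    & forall p, laplacian_at (@complex.Re R \o f) p (- lam * complex.Re (f p)) /\
                laplacian_at (@complex.Im R \o f) p (- lam * complex.Im (f p))].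

End Smoothness.

Section EigenBasis.
Variables (R : realType) (M : two_point_space).
Variable mu : probability (borel_mfd R M) R.

Definition isometry_invariant : Prop :=
  forall g : mfd R M -> mfd R M, bijective g ->
    (forall x y, gdist (g x) (g y) = gdist x y) ->
    forall A : set (borel_mfd R M), measurable A -> mu (g @^-1` A) = mu A.

Definition normsq (z : R[i]) : R := complex.Re z ^+ 2 + complex.Im z ^+ 2.

Definition square_integrable (h : mfd R M -> R[i]) : Prop :=
  [/\ measurable_fun [set: borel_mfd R M] (@complex.Re R \o h),
      measurable_fun [set: borel_mfd R M] (@complex.Im R \o h)
    & (\int[mu]_x (normsq (h x))%:E < +oo)%E].

Definition L2dot (g h : mfd R M -> R[i]) : R[i] :=
  (\int[mu]_x complex.Re (g x * (h x)^*)) +i* (\int[mu]_x complex.Im (g x * (h x)^*)).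

Implicit Type h : mfd R M -> R[i].

(* The index j = 1, ..., m_k is represented by an element of 'I_(m k). *)
Variables (m : nat -> nat) (f : forall k, 'I_(m k) -> mfd R M -> R[i]).

Definition orthonormal_family : Prop :=
  forall k (j : 'I_(m k)) k' (j' : 'I_(m k')),
    L2dot (f j) (f j') =
    (Tagged (fun k => 'I_(m k)) j == Tagged (fun k => 'I_(m k)) j')%:R.

(* density of the linear span in L^2 *)
Definition complete_family : Prop :=
  forall h, square_integrable h -> forall e : R, 0 < e ->
    exists (n : nat) (a : forall k, 'I_(m k) -> R[i]),
      (\int[mu]_x (normsq (h x - \sum_(k < n) \sum_j a k j * f j x))%:E < e%:E)%E.

(* [lam] enumerates increasingly the eigenvalues of minus the Laplace-Beltrami
   operator, and the functions [f (k := k) j] are a basis of the [lam k]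
   eigenspace (their linear independence is part of orthonormality). *)
Record eigen_basis (lam : nat -> R) : Prop := EigenBasis {
  eigen_lam0 : lam 0%N = 0;
  eigen_lam_incr : {homo lam : k l / (k < l)%N >-> k < l};
  eigen_mult_gt0 : forall k, (0 < m k)%N;
  eigen_fun : forall k (j : 'I_(m k)), smooth_eigenfunction (lam k) (f j);
  eigen_exhaust : forall (l : R) (h : mfd R M -> R[i]), smooth_eigenfunction l h ->
    (exists x, h x != 0) -> exists k, l = lam k;
  eigen_span : forall k (h : mfd R M -> R[i]), smooth_eigenfunction (lam k) h ->
    exists a : 'I_(m k) -> R[i], forall x, h x = \sum_j a j * f j x;
  eigen_orthonormal : orthonormal_family;
  eigen_complete : complete_family
}.

End EigenBasis.

Section Jacobi.
Variable R : realType.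

Definition Gamma (x : R) : R :=
  \int[lebesgue_measure]_(t in `]0, +oo[) (t `^ (x - 1) * expR (- t)).

Definition gbinomial (a : R) (n : nat) : R :=
  (\prod_(i < n) (a - i%:R)) / n`!%:R.

(* P_n^(a,b)(x) = \sum_s C(n+a, n-s) C(n+b, s) ((x-1)/2)^s ((x+1)/2)^(n-s),
   whose value at 1 is C(n+a, n) = Gamma(n+a+1) / (Gamma(n+1) Gamma(a+1)) *)
Definition jacobi (a b : R) (n : nat) : {poly R} :=
  \sum_(s < n.+1) (gbinomial (n%:R + a) (n - s) * gbinomial (n%:R + b) s) *:
    ((2^-1 *: ('X - 1)) ^+ s * (2^-1 *: ('X + 1)) ^+ (n - s)).

Definition mfd_alpha (M : two_point_space) : R := ((mfd_d M)%:R - 3) / 2.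

Definition mfd_beta (M : two_point_space) : R :=
  match M with
  | Sphere d _ => (d%:R - 3) / 2
  | Projective RealNumbers _ _ => - 2^-1
  | Projective ComplexNumbers _ _ => 0
  | Projective Quaternions _ _ => 1
  | CayleyPlane => 3
  end.

Definition mfd_jacobi (M : two_point_space) (k : nat) : {poly R} :=
  jacobi (mfd_alpha M) (mfd_beta M) k.

Definition mfd_c (M : two_point_space) (k : nat) : R :=
  let a := mfd_alpha M in let b := mfd_beta M in
  (Gamma (b + 1) * (2 * k%:R + a + b + 1) * Gamma (k%:R + a + b + 1)) /
  (Gamma (a + b + 2) * Gamma (k%:R + b + 1)).

Definition addition_formula (M : two_point_space) (m : nat -> nat)
    (f : forall k, 'I_(m k) -> mfd R M -> R[i]) : Prop :=
  forall k x y, \sum_j f k j x * (f k j y)^* =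
    (mfd_c M k * (mfd_jacobi M k).[cos (gdist x y)])%:C.

End Jacobi.

Section Kernels.
Variables (R : realType) (M : two_point_space).
Implicit Type K : mfd R M -> mfd R M -> R[i].

Definition hermitian_kernel K : Prop := forall x y, K y x = (K x y)^*.

Definition kernel_form K n (x : 'I_n -> mfd R M) (c : 'I_n -> R[i]) : R[i] :=
  \sum_i \sum_j (c i)^* * K (x i) (x j) * c j.

Definition positive_definite K : Prop :=
  hermitian_kernel K /\
  forall n (x : 'I_n -> mfd R M), injective x ->
    forall c : 'I_n -> R[i], 0 <= kernel_form K x c.

Definition strictly_positive_definite K : Prop :=
  hermitian_kernel K /\
  forall n (x : 'I_n -> mfd R M), injective x ->
    forall c : 'I_n -> R[i], (exists i, c i != 0) -> 0 < kernel_form K x c.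

Definition continuous_kernel K : Prop :=
  continuous ((fun xy => K xy.1 xy.2) : mfd R M * mfd R M -> R[i]^o).

Variables (m : nat -> nat) (f : forall k, 'I_(m k) -> mfd R M -> R[i]).

Definition has_expansion (d : forall k, 'I_(m k) -> R) K : Prop :=
  forall x y,
    (\sum_(0 <= k < n) \sum_j (d k j)%:C * f j x * (f j y)^* : R[i]^o)
      @[n --> \oo] --> (K x y : R[i]^o).

(* An index pair (j, k) is the dependent pair of k and j : 'I_(m k). *)
Definition induces_strict_positive_definiteness (F : set {k : nat & 'I_(m k)}) :
    Prop :=
  forall (d : forall k, 'I_(m k) -> R) K,
    (forall k j, 0 <= d k j) ->
    [set p : {k : nat & 'I_(m k)} | 0 < d (tag p) (tagged p)] = F ->
    has_expansion d K -> continuous_kernel K -> positive_definite K ->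
    strictly_positive_definite K.

End Kernels.

(* Main.v *)
(* If the form of K at (x, c) vanishes, then every f_{j,k} with (j,k) in F is
   annihilated by the functional g |-> sum_i conj(c_i) g(x_i).  Summing the
   squares over all j, the addition formula gives, for k in N,
     sum_{i,l} conj(c_i) c_l p_k(cos d(x_i, x_l)) -> 0,  p_k = P_k / P_k(1),
   because only the indices j outside A_k contribute.  Now p_k(1) = 1 and
   p_k(t) -> 0 for -1 < t < 1, while p_k(-1) -> 0 if beta < alpha and
   p_k(-1) = (-1)^k on the sphere.  Along N, or by adding the limits along the
   even and the odd elements of N, only the diagonal survives: sum |c_i|^2 = 0.

   The decay of p_k inside ]-1, 1[ comes from the three-term recurrence: after
   rescaling by weights growing like k^(alpha + 1/2) it is an O(1/k^2)
   perturbation of the Chebyshev recurrence u_{k+1} = 2 t u_k - u_{k-1}, whose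
   conserved energy u_k^2 - 2 t u_k u_{k+1} + u_{k+1}^2 is positive definite. *)

Require Import Defs.
From HB Require Import structures.
From mathcomp Require Import all_boot all_order all_algebra.
From mathcomp Require Import all_classical all_reals all_analysis.
From mathcomp Require Import complex.
From mathcomp Require Import ring lra.
Import Order.TTheory GRing.Theory Num.Theory.
Import numFieldNormedType.Exports.
Local Open Scope classical_set_scope.
Local Open Scope ring_scope.
Local Open Scope complex_scope.

Set Implicit Arguments.
Unset Strict Implicit.
Unset Printing Implicit Defensive.

(** * The three-term recurrence of Jacobi polynomials *)

Section JacobiRecurrence.
Variable R : realType.
Implicit Types (a b x X Y : R) (n s j : nat).

(** The Pochhammer symbol (a+1)_n. *)
Definition rising a n : R := \prod_(i < n) (a + 1 + i%:R).

Lemma risingS a n : rising a n.+1 = rising a n * (a + 1 + n%:R).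
Proof. by rewrite /rising big_ord_recr. Qed.

Lemma rising_gt0 a n : -1 < a -> 0 < rising a n.
Proof.
move=> a1; apply: prodr_gt0 => i _.
by rewrite ltr_wpDr ?ler0n// -ltrBlDr sub0r.
Qed.

(** The numerator of the binomial coefficient consists of the last j factors of (a+1)_{s+j}. *)
Lemma gbinomial_rising a s j :
  gbinomial ((s + j)%:R + a) j * rising a s * j`!%:R = rising a (s + j).
Proof.
rewrite /gbinomial mulrAC divfK ?pnatr_eq0 -?lt0n ?fact_gt0//.
elim: j => [|j IH]; first by rewrite big_ord0 mul1r addn0.
rewrite addnS risingS -IH big_ord_recl /= subr0.
under eq_bigr => i _.
  rewrite (_ : _ - _ = (s + j)%:R + a - i%:R); first by over.
  by rewrite /bump /= add1n -!natr1; ring.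
by rewrite -natr1; ring.
Qed.

(** Coefficient of z^s in 0F1(; a+1; z). Up to a factor, P_n is the part of degree n of 0F1(; a+1;
    X) 0F1(; b+1; Y), where X = (x-1)/2 and Y = (x+1)/2. *)
Definition phi a s : R := (rising a s * s`!%:R)^-1.

Lemma phi0 a : phi a 0 = 1.
Proof. by rewrite /phi /rising big_ord0 fact0 mulr1 invr1. Qed.

Lemma phiS a s : -1 < a -> phi a s = s.+1%:R * (s.+1%:R + a) * phi a s.+1.
Proof.
move=> a1; rewrite /phi risingS factS natrM -natr1.
have r0 : rising a s != 0 by rewrite gt_eqF// rising_gt0.
have f0 : s`!%:R != 0 :> R by rewrite pnatr_eq0 -lt0n fact_gt0.
have s0 : s%:R + 1 != 0 :> R by rewrite natr1 pnatr_eq0.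
have sa : a + 1 + s%:R != 0.
  by rewrite gt_eqF// ltr_wpDr ?ler0n// -ltrBlDr sub0r.
by field; rewrite f0 sa r0 s0.
Qed.

(** The weight [c] takes real arguments, so that s - 1 and j - 1 are not truncated and weights can
    be compared by [ring]. *)
Definition hsum a b X Y (c : R -> R -> R) n : R :=
  \sum_(s < n.+1) c s%:R (n - s)%:R *
    (phi a s * phi b (n - s) * X ^+ s * Y ^+ (n - s)).

(** C(n+a, n-s) = (a+1)_n / ((a+1)_s (n-s)!), and likewise for C(n+b, s). *)
Lemma jacobi_hsum a b n x : -1 < a -> -1 < b ->
  (jacobi a b n).[x] = rising a n * rising b n *
    hsum a b ((x - 1) / 2) ((x + 1) / 2) (fun _ _ => 1) n.
Proof.
move=> a1 b1; rewrite /jacobi horner_sum /hsum mulr_sumr; apply: eq_bigr => s _.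
rewrite hornerZ hornerM !horner_exp !hornerZ hornerXsubC hornerD hornerX hornerC.
have sn : (s <= n)%N by rewrite -ltnS.
have := gbinomial_rising a s (n - s); rewrite subnKC// => <-.
have := gbinomial_rising b (n - s) s; rewrite subnK// => <-.
rewrite /phi.
have ra : rising a s != 0 by rewrite gt_eqF// rising_gt0.
have rb : rising b (n - s) != 0 by rewrite gt_eqF// rising_gt0.
have f0 : s`!%:R != 0 :> R by rewrite pnatr_eq0 -lt0n fact_gt0.
have f1 : (n - s)`!%:R != 0 :> R by rewrite pnatr_eq0 -lt0n fact_gt0.
rewrite (mulrC 2^-1 (x - 1)) (mulrC 2^-1 (x + 1)).
move: (_ ^+ _) (_ ^+ _) => u v.
by field; rewrite f0 f1 ra rb.
Qed.

(** Multiplication by X shifts s by one. The factor s (s + a) from [phiS] vanishes at s = 0, so the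
    new boundary term is zero. *)
Lemma hsumX a b X Y c n : -1 < a ->
  X * hsum a b X Y c n =
  hsum a b X Y (fun s j : R => s * (s + a) * c (s - 1) j) n.+1.
Proof.
move=> a1; rewrite /hsum [RHS]big_ord_recl /= !mul0r add0r mulr_sumr.
apply: eq_bigr => s _; rewrite /bump /= add1n subSS (phiS s a1) exprS.
by rewrite -natr1 addrK; ring.
Qed.

Lemma hsumY a b X Y c n : -1 < b ->
  Y * hsum a b X Y c n =
  hsum a b X Y (fun s j : R => j * (j + b) * c s (j - 1)) n.+1.
Proof.
move=> b1; rewrite /hsum [RHS]big_ord_recr /= subnn !mul0r addr0 mulr_sumr.
apply: eq_bigr => s _; rewrite (subSn (leq_ord s)) (phiS (n - s) b1) exprS.
by rewrite -natr1 addrK; ring.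
Qed.

Lemma hsumZ a b X Y c n (u : R) :
  u * hsum a b X Y c n = hsum a b X Y (fun s j : R => u * c s j) n.
Proof. by rewrite /hsum mulr_sumr; apply: eq_bigr => s _; rewrite mulrA. Qed.

Lemma hsumD a b X Y c d n :
  hsum a b X Y c n + hsum a b X Y d n =
  hsum a b X Y (fun s j : R => c s j + d s j) n.
Proof. by rewrite /hsum -big_split; apply: eq_bigr => s _; rewrite mulrDl. Qed.

Lemma eq_hsum a b X Y c d n :
  (forall s j : R, s + j = n%:R -> c s j = d s j) ->
  hsum a b X Y c n = hsum a b X Y d n.
Proof.
move=> cd; apply: eq_bigr => s _; rewrite cd// -natrD subnKC//.
by rewrite -ltnS.
Qed.

(* With [1 = Y - X] and [x = X + Y] every term is homogeneous of degree n + 2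
   in (X, Y), and the recurrence holds coefficientwise. *)
Lemma hsum_rec a b x n : -1 < a -> -1 < b ->
  let X := (x - 1) / 2 in let Y := (x + 1) / 2 in
  let h := hsum a b X Y (fun _ _ => 1) in
  let N := n.+1%:R in let M := 2 * N + a + b in
  2 * (N + 1) * (N + a + b + 1) * M * (N + a + 1) * (N + b + 1) * h n.+2 =
  (M + 1) * ((M + 2) * M * x + (a ^+ 2 - b ^+ 2)) * h n.+1
    - 2 * (M + 2) * h n.
Proof.
move=> a1 b1 X Y h N M.
have YX : Y = X + 1 by rewrite /X /Y; field.
have XY : x = X + Y by rewrite /X /Y; field.
clearbody X Y.
have {YX XY} -> : (M + 1) * ((M + 2) * M * x + (a ^+ 2 - b ^+ 2)) * h n.+1
    - 2 * (M + 2) * h n =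
    (M + 1) * ((M + 2) * M + (a ^+ 2 - b ^+ 2)) * (Y * h n.+1)
    + (M + 1) * ((M + 2) * M - (a ^+ 2 - b ^+ 2)) * (X * h n.+1)
    + (- 2 * (M + 2) * (Y * (Y * h n)) + 4 * (M + 2) * (X * (Y * h n))
       + - 2 * (M + 2) * (X * (X * h n))).
  by rewrite XY YX; ring.
rewrite /h !(hsumX, hsumY)// !hsumZ !hsumD; apply: eq_hsum => s j sj.
(* Every term now has degree s + j = n + 2 = N + 1; eliminating N leaves a polynomial identity in s,
   j, a, b. *)
rewrite /M (_ : N = s + j - 1); last by rewrite sj -[n.+2%:R]natr1 addrK.
ring.
Qed.

End JacobiRecurrence.

(** * Decay inside the interval of orthogonality *)

Section Decay.
Variable R : realType.
Implicit Types (a b x : R) (n : nat).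

Lemma series_harmonic_dvg : series (@harmonic R) @ \oo --> +oo.
Proof.
apply: nondecreasing_dvgn_lt; last exact: dvg_harmonic.
by apply: nondecreasing_series => n _ _; exact: harmonic_ge0.
Qed.

(** With T increasing by u = g/(n+1) from T(n0) = 1, the product e T does not increase past n0,
    because (1 - u)(T + u) <= T when T >= 1. Since T diverges like the harmonic series, e tends to
    0. *)
Lemma cvg0_of_harmonic_decay (e : nat -> R) (g : R) (n0 : nat) : 0 < g ->
  (forall n, 0 <= e n) ->
  (forall n, (n0 <= n)%N -> e n.+1 <= (1 - g / n.+1%:R) * e n) ->
  e @ \oo --> 0.
Proof.
move=> g0 e0 H.
pose T n := 1 + g * (series (@harmonic R) n - series (@harmonic R) n0).
have T1 n : (n0 <= n)%N -> 1 <= T n.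
  move=> nn; rewrite lerDl mulr_ge0 ?(ltW g0)// subr_ge0.
  by apply: nondecreasing_series => // k _ _; exact: harmonic_ge0.
have Te n : (n0 <= n)%N -> e n * T n <= e n0.
  elim: n => [|n IH].
    by rewrite leqn0 => /eqP n00; rewrite /T n00 subrr mulr0 addr0 mulr1.
  rewrite leq_eqVlt => /predU1P[<-|nn].
    by rewrite /T subrr mulr0 addr0 mulr1.
  apply: le_trans (IH nn); have TS : T n.+1 = T n + g / n.+1%:R.
    by rewrite /T seriesSr /=; ring.
  have u0 : 0 < g / n.+1%:R by rewrite divr_gt0// ltr0n.
  have Tn := T1 _ nn.
  apply: le_trans (_ : (1 - g / n.+1%:R) * e n * T n.+1 <= _).
    by rewrite ler_wpM2r ?H// TS addr_ge0 ?(ltW u0)// (le_trans ler01).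
  rewrite TS mulrAC -subr_ge0; move: (_ / _) (T n) u0 Tn (e0 n) => u t u0 t1 en.
  have -> : e n * t - (1 - u) * (t + u) * e n = e n * u * (t - 1 + u) by ring.
  by rewrite !mulr_ge0//; lra.
have TV : (T n)^-1 @[n --> \oo] --> (0 : R).
  apply/gtr0_cvgV0.
    by exists n0 => // n /= nn; rewrite (lt_le_trans _ (T1 _ nn)).
  apply/cvgryPge => A; move/cvgryPge : series_harmonic_dvg.
  move=> /(_ (series harmonic n0 + A / g)); apply: filterS => n.
  rewrite -lerBrDl ler_pdivrMr// /T => h; rewrite (le_trans h)// mulrC.
  by rewrite lerDr.
apply: (@squeeze_cvgr _ _ _ _ (cst 0) (fun n => e n0 * (T n)^-1)).
- exists n0 => // n /= nn; rewrite e0/= ler_pdivlMr ?Te//.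
  exact: lt_le_trans (T1 _ nn).
- exact: cvg_cst.
- by rewrite -[X in _ --> X](mulr0 (e n0)); apply: cvgMl_tmp.
Qed.

(** From 2|uv| <= u^2 + v^2. For |x| < 1 this makes the energy positive definite. *)
Lemma energy_ge (x u v : R) :
  (1 - `|x|) * (u ^+ 2 + v ^+ 2) <= v ^+ 2 - 2 * x * u * v + u ^+ 2.
Proof.
rewrite -subr_ge0.
rewrite (_ : _ - _ = `|x| * (u ^+ 2 + v ^+ 2) - 2 * x * u * v); last by ring.
rewrite subr_ge0 (le_trans (ler_norm _))//.
rewrite !normrM (ger0_norm (_ : 0 <= 2 :> R))//.
rewrite -(real_normK (num_real u)) -(real_normK (num_real v)).
rewrite (_ : _ * _ * _ * _ = `|x| * (2 * `|u| * `|v|)); last by ring.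
rewrite ler_wpM2l// -subr_ge0.
by rewrite (_ : _ - _ = (`|u| - `|v|) ^+ 2) ?sqr_ge0//; ring.
Qed.

(** Without d1 and d2 the energy is conserved. The perturbation [e] changes it by e (e + 2xv - 2u),
    of modulus at most 3 eta (|u| + |v|)^2 <= 6 eta (u^2 + v^2), and [energy_ge] bounds u^2 + v^2 by
    q / (1 - |x|). *)
Lemma energy_step (x u v d1 d2 eta w q : R) :
  `|x| < 1 -> `|d1| <= eta -> `|d2| <= eta -> eta <= 1 ->
  w = (2 * x + d1) * v - (1 + d2) * u ->
  q = v ^+ 2 - 2 * x * u * v + u ^+ 2 ->
  w ^+ 2 - 2 * x * v * w + v ^+ 2 <= (1 + 6 / (1 - `|x|) * eta) * q.
Proof.
move=> x1 d1e d2e eta1 wE qE.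
have eta0 : 0 <= eta := le_trans (normr_ge0 d1) d1e.
pose s := 1 - `|x|; have s0 : 0 < s by rewrite subr_gt0.
pose e := d1 * v - d2 * u.
have -> : w ^+ 2 - 2 * x * v * w + v ^+ 2 = q + e * (e + 2 * x * v - 2 * u).
  by rewrite wE qE /e; ring.
pose m := `|u| + `|v|.
have em : `|e| <= eta * m.
  rewrite (le_trans (ler_normB _ _))// !normrM /m mulrDr addrC.
  by rewrite lerD// ler_wpM2r.
have e3 : `|e + 2 * x * v - 2 * u| <= 3 * m.
  rewrite (le_trans (ler_normB _ _))// normrM (ger0_norm (_ : 0 <= 2 :> R))//.
  have := le_trans em (ler_piMl (addr_ge0 (normr_ge0 u) (normr_ge0 v)) eta1).
  have : `|2 * x * v| <= 2 * `|v|.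
    rewrite !normrM (ger0_norm (_ : 0 <= 2 :> R))// -mulrA ler_pM2l//.
    by rewrite ler_piMl// ltW.
  have := ler_normD e (2 * x * v); rewrite /m; lra.
have sq : s * (u ^+ 2 + v ^+ 2) <= q by rewrite qE energy_ge.
have mq : 3 * eta * m ^+ 2 <= 6 / s * eta * q.
  have -> : 6 / s * eta * q = 3 * eta * (2 * (q / s)) by field; rewrite gt_eqF.
  rewrite ler_wpM2l ?mulr_ge0//.
  rewrite (@le_trans _ _ (2 * (u ^+ 2 + v ^+ 2)))//.
    rewrite /m -(real_normK (num_real u)) -(real_normK (num_real v)) -subr_ge0.
    by rewrite (_ : _ - _ = (`|u| - `|v|) ^+ 2) ?sqr_ge0//; ring.
  by rewrite ler_pM2l// ler_pdivlMr// mulrC.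
rewrite [leRHS]mulrDl mul1r lerD2l (le_trans _ mq)// (le_trans (ler_norm _))//.
rewrite normrM (le_trans (ler_pM _ _ em e3))// le_eqVlt; apply/orP; left.
by apply/eqP; ring.
Qed.

End Decay.

(** * Jacobi polynomials normalized to the value 1 at 1 *)

Section NormalizedJacobi.
Variable R : realType.
Implicit Types (a b x : R) (n : nat).

(** The point x = 1, where only the term s = 0 survives. *)
Lemma hsum_X0 a b (Y : R) n : hsum a b 0 Y (fun _ _ => 1) n = phi b n * Y ^+ n.
Proof.
rewrite /hsum big_ord_recl big1 => [|s _]; first by rewrite /= subn0 phi0; ring.
by rewrite lift0 expr0n mulr0 mul0r mulr0.
Qed.

(** The point x = -1, where only the term s = n survives. *)
Lemma hsum_Y0 a b (X : R) n : hsum a b X 0 (fun _ _ => 1) n = phi a n * X ^+ n.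
Proof.
rewrite /hsum big_ord_recr big1 => [|s _]; first by rewrite /= subnn phi0; ring.
by rewrite /= expr0n subn_eq0 leqNgt ltn_ord /= !mulr0.
Qed.

(** This is P_n(x) / P_n(1), with the common factor (a+1)_n cancelled; see [njacobiE]. *)
Definition njacobi a b n x : R :=
  n`!%:R * rising b n * hsum a b ((x - 1) / 2) ((x + 1) / 2) (fun _ _ => 1) n.

Lemma jacobi_at1 a b n : -1 < a -> -1 < b ->
  (jacobi a b n).[1] = rising a n / n`!%:R.
Proof.
move=> a1 b1; rewrite jacobi_hsum// subrr mul0r hsum_X0.
rewrite (_ : (1 + 1) / 2 = 1 :> R); last by field.
have rb : rising b n != 0 by rewrite gt_eqF// rising_gt0.
have f0 : n`!%:R != 0 :> R by rewrite pnatr_eq0 -lt0n fact_gt0.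
by rewrite expr1n mulr1 /phi; field; rewrite f0 rb.
Qed.

Lemma jacobi_at1_gt0 a b n : -1 < a -> -1 < b -> 0 < (jacobi a b n).[1].
Proof.
by move=> a1 b1; rewrite jacobi_at1// divr_gt0 ?rising_gt0 ?ltr0n ?fact_gt0.
Qed.

Lemma njacobiE a b n x : -1 < a -> -1 < b ->
  njacobi a b n x = (jacobi a b n).[x] / (jacobi a b n).[1].
Proof.
move=> a1 b1; rewrite jacobi_at1// jacobi_hsum// /njacobi.
have ra : rising a n != 0 by rewrite gt_eqF// rising_gt0.
have f0 : n`!%:R != 0 :> R by rewrite pnatr_eq0 -lt0n fact_gt0.
by field; rewrite f0 ra.
Qed.

Lemma njacobi1 a b n : -1 < a -> -1 < b -> njacobi a b n 1 = 1.
Proof.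
by move=> a1 b1; rewrite njacobiE// divff// gt_eqF// jacobi_at1_gt0.
Qed.

Lemma njacobiN1 a b n : -1 < a ->
  njacobi a b n (-1) = (-1) ^+ n * (rising b n / rising a n).
Proof.
move=> a1; rewrite /njacobi addNr mul0r hsum_Y0.
rewrite (_ : (-1 - 1) / 2 = -1 :> R); last by field.
have ra : rising a n != 0 by rewrite gt_eqF// rising_gt0.
have f0 : n`!%:R != 0 :> R by rewrite pnatr_eq0 -lt0n fact_gt0.
by rewrite /phi; move: (_ ^+ n) => u; field; rewrite ra f0.
Qed.

Lemma njacobi_rec a b n x : -1 < a -> -1 < b ->
  let N := n.+1%:R in let M := 2 * N + a + b in
  2 * (N + a + b + 1) * M * (N + a + 1) * njacobi a b n.+2 x =
  (M + 1) * ((M + 2) * M * x + (a ^+ 2 - b ^+ 2)) * njacobi a b n.+1 x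
    - 2 * N * (N + b) * (M + 2) * njacobi a b n x.
Proof.
move=> a1 b1 N M; have := @hsum_rec R a b x n a1 b1.
rewrite /njacobi -/N -/M.
move: (hsum _ _ _ _ _ _) (hsum _ _ _ _ _ _) (hsum _ _ _ _ _ _) => h0 h1 h2 H.
rewrite !risingS !factS !natrM -/N.
rewrite (_ : n%:R = N - 1); last by rewrite /N -natr1 addrK.
rewrite (_ : n.+2%:R = N + 1); last by rewrite natr1.
move: (n`!%:R) (rising b n) => F r.
(* The recurrence of the sums is multiplied by (n+1)! (b+1)_{n+1}. *)
transitivity (N * F * (r * (b + N)) * (2 * (N + 1) * (N + a + b + 1) * M *
  (N + a + 1) * (N + b + 1) * h2)); first by ring.
by rewrite H; ring.
Qed.

End NormalizedJacobi.

(** * Limits of the normalized polynomials on [-1, 1] *)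

Section JacobiDecay.
Variable R : realType.
Implicit Types (a b x : R) (n : nat).

(** Quotient w_{n+1} / w_n of the weights w_n = (a+1)_n / (1/2)_n, which grow like n^(a + 1/2). *)
Definition jratio a n : R := (n%:R + a + 1) / (n%:R + 2^-1).

Lemma norm_div_le_sqr (t d c : R) (N : R) : 0 < d -> 0 <= c ->
  `|t| * N ^+ 2 <= c * d -> 0 < N -> `|t / d| <= c / N ^+ 2.
Proof.
move=> d0 c0 h N0; rewrite normrM normfV (gtr0_norm d0).
by rewrite ler_pdivrMr// mulrAC ler_pdivlMr// exprn_gt0.
Qed.

(* The leading coefficients cancel up to O(1/n^2) because [jratio a n] is
   1 + (a + 1/2) / n + O(1/n^2), the growth rate of the orthonormalized
   polynomials. *)
Lemma njacobi_perturbation a b x : - 2^-1 < a -> - 2^-1 <= b -> `|x| <= 1 ->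
  exists2 C : R, 0 <= C & forall n, exists d : R * R,
    [/\ `|d.1| <= C / n.+1%:R ^+ 2, `|d.2| <= C / n.+1%:R ^+ 2 &
    jratio a n.+1 * jratio a n * njacobi a b n.+2 x =
    (2 * x + d.1) * (jratio a n * njacobi a b n.+1 x)
    - (1 + d.2) * njacobi a b n x].
Proof.
move=> a2 b2 x1.
pose s := a + b.
(* The numerators of the two errors chosen below are at most c1 M and (c2 / 2) N^2 in modulus, with
   N = n + 1 and M = 2N + s; u2, u1, u0 are the coefficients of the second one. *)
pose c1 := `|s ^+ 2 + s| + 2 * `|a ^+ 2 - b ^+ 2|.
pose u2 := s + 2 * a * b + 2^-1.
pose u1 := a * b * (s + 2) + (3 * s + 2) / 4.
pose u0 := s * (s + 1) / 4.
pose c2 := 2 * (`|u2| + `|u1| + `|u0|).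
have c1_0 : 0 <= c1 by rewrite addr_ge0// mulr_ge0.
have c2_0 : 0 <= c2 by rewrite mulr_ge0// !addr_ge0.
exists (c1 + c2) => [|n]; first exact: addr_ge0.
have n0 : 0 <= n%:R :> R by [].
have a1 : -1 < a by lra.
have b1 : -1 < b by lra.
have := njacobi_rec n x a1 b1 => /=.
rewrite /jratio (_ : n.+1%:R = n%:R + 1); last by rewrite natr1.
move: (njacobi _ _ _ _) (njacobi _ _ _ _) (njacobi _ _ _ _) => p0 p1 p2.
set N := n%:R + 1; have N1 : 1 <= N by rewrite lerDr.
rewrite (_ : n%:R = N - 1); last by rewrite addrK.
 move: N N1 => N N1.
rewrite (_ : 2 * N + a + b = 2 * N + s); last by rewrite addrA.
set M := 2 * N + s => rec.
have N0 : 0 < N by lra.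
have MN : N <= M by rewrite /M /s; lra.
have M0 : 0 < M by lra.
have Ns : N <= N + s + 1 by rewrite /s; lra.
have Ns0 : 0 < N + s + 1 by lra.
have Na : N + a + 1 != 0 by rewrite gt_eqF//; lra.
have Nh : 0 < 2 * N + 1 by lra.
have Nm : 0 < 2 * N - 1 by lra.
(* These are the coefficients of [njacobi_rec], rescaled by [jratio] and solved for p2, minus the
   Chebyshev coefficients 2x and 1. The factor N^2 - 1/4 is the product of the denominators N + 1/2
   and N - 1/2 of the two ratios. *)
exists ((x * (s ^+ 2 + s) * M + (M + 1) * (a ^+ 2 - b ^+ 2)) /
        ((N + s + 1) * M * (2 * N + 1)),
        (u2 * N ^+ 2 + u1 * N + u0) /
        ((N + s + 1) * M * (N ^+ 2 - 4^-1))); split => /=.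
- apply: (@le_trans _ _ (c1 / N ^+ 2)); last first.
    by rewrite ler_wpM2r ?lerDl// invr_ge0 exprn_ge0// ltW.
  apply: norm_div_le_sqr => //; first by rewrite !mulr_gt0.
  have t1 : `|x * (s ^+ 2 + s) * M + (M + 1) * (a ^+ 2 - b ^+ 2)| <= c1 * M.
    rewrite (le_trans (ler_normD _ _))// /c1 [leRHS]mulrDl !normrM.
    rewrite (gtr0_norm M0). rewrite (gtr0_norm (_ : 0 < M + 1)); last by lra.
    rewrite lerD//.
      by rewrite ler_wpM2r ?(ltW M0)// ler_piMl.
    rewrite (_ : 2 * _ * M = 2 * M * `|a ^+ 2 - b ^+ 2|); last by ring.
    by rewrite ler_wpM2r//; lra.
  apply: le_trans (_ : c1 * M * N ^+ 2 <= _).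
    by rewrite ler_wpM2r// exprn_ge0// ltW.
  rewrite -!mulrA ler_wpM2l// [leRHS]mulrCA ler_wpM2l ?(ltW M0)// expr2.
  by rewrite ler_pM//; lra.
- apply: (@le_trans _ _ (c2 / N ^+ 2)); last first.
    by rewrite ler_wpM2r ?lerDr// invr_ge0 exprn_ge0// ltW.
  have NN : N <= N ^+ 2 by rewrite expr2 ler_peMl// ltW.
  have N2 : N ^+ 2 <= 2 * (N ^+ 2 - 4^-1) by lra.
  apply: norm_div_le_sqr => //; first by rewrite !mulr_gt0//; lra.
  have t2 : `|u2 * N ^+ 2 + u1 * N + u0| <= (`|u2| + `|u1| + `|u0|) * N ^+ 2.
    rewrite (le_trans (ler_normD _ _))// [leRHS]mulrDl lerD//; last first.
      by rewrite ler_peMr//; lra.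
    rewrite (le_trans (ler_normD _ _))// [leRHS]mulrDl lerD//.
      by rewrite normrM (ger0_norm (_ : 0 <= N ^+ 2)) ?exprn_ge0 ?(ltW N0).
    by rewrite normrM (gtr0_norm N0) ler_wpM2l.
  apply: le_trans (_ : (`|u2| + `|u1| + `|u0|) * N ^+ 2 * N ^+ 2 <= _).
    by rewrite ler_wpM2r// exprn_ge0// ltW.
  rewrite /c2 -(mulrA _ (N ^+ 2)) (mulrC 2) -(mulrA _ 2).
  rewrite ler_wpM2l ?addr_ge0// [leRHS]mulrCA.
  by rewrite ler_pM ?exprn_ge0 ?(ltW N0)// expr2 ler_pM// ltW.
- have A0 : 2 * (N + a + b + 1) * M * (N + a + 1) != 0.
    rewrite !mulf_neq0// ?gt_eqF//; lra.
  have -> : p2 = ((M + 1) * ((M + 2) * M * x + (a ^+ 2 - b ^+ 2)) * p1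
      - 2 * N * (N + b) * (M + 2) * p0) / (2 * (N + a + b + 1) * M * (N + a + 1)).
    by rewrite -rec mulrC mulKf.
  rewrite /u2 /u1 /u0 /M /s.
  have N4 : N ^+ 2 * 4 - 1 != 0.
    by rewrite (_ : _ - 1 = (2 * N + 1) * (2 * N - 1)) ?mulf_neq0 ?gt_eqF//; ring.
  have Nm' : (N - 1) * 2 + 1 != 0 by rewrite gt_eqF//; lra.
  have NM : 2 * N + (a + b) != 0 by rewrite gt_eqF.
  have NS : N + (a + b) + 1 != 0 by rewrite gt_eqF.
  by field; rewrite N4 NM NS Nm' Na gt_eqF.
Qed.

(** Let r_n = [jratio a n] and N = n + 1. By [energy_step], the energy e_n of the pair (p_n, r_n
    p_{n+1}) satisfies r_n^2 e_{n+1} <= (1 + K/N^2) e_n. Since r_n >= 1 + g/N with g = a + 1/2 > 0,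
    it follows that e_{n+1} <= (1 - g/N) e_n for large n; and e_n dominates p_n^2. *)
Lemma njacobi_cvg0 a b x : - 2^-1 < a -> - 2^-1 <= b -> `|x| < 1 ->
  njacobi a b n x @[n --> \oo] --> 0.
Proof.
move=> a2 b2 x1.
have [C C0 HC] := njacobi_perturbation a2 b2 (ltW x1).
pose p n := njacobi a b n x.
pose e n := (jratio a n * p n.+1) ^+ 2 - 2 * x * p n * (jratio a n * p n.+1)
  + p n ^+ 2.
have s0 : 0 < 1 - `|x| by rewrite subr_gt0.
have pe n : (1 - `|x|) * p n ^+ 2 <= e n.
  rewrite (le_trans _ (energy_ge x (p n) (jratio a n * p n.+1)))//.
  by rewrite ler_wpM2l ?(ltW s0)// lerDl sqr_ge0.
have e0 n : 0 <= e n by rewrite (le_trans _ (pe n))// mulr_ge0 ?sqr_ge0 ?(ltW s0).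
pose g := a + 2^-1; have g0 : 0 < g by rewrite /g; lra.
pose K := 6 / (1 - `|x|) * C.
have K0 : 0 <= K by rewrite mulr_ge0// divr_ge0// ltW.
(* For N > B one has N > 1, C/N^2 <= 1, g/N <= 1 and N >= 2g + K/g; the last is the condition for (1
   + 2g/N)(1 - g/N) >= 1 + K/N^2. *)
pose B := C + 1 + 2 * g + K / g.
have Kg : 0 <= K / g by rewrite divr_ge0// ltW.
have B0 : 0 <= B by rewrite /B; lra.
have ecv : e @ \oo --> 0.
  apply: (@cvg0_of_harmonic_decay _ _ g (Num.bound B)) => // n nB.
  have [[d1 d2] /= [d1C d2C rec]] := HC n.
  have NB : B < n.+1%:R.
    by rewrite (lt_le_trans (archi_boundP B0))// ler_nat (leq_trans nB).
  have rE : jratio a n = (n.+1%:R + a) / (n.+1%:R - 2^-1).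
    by rewrite /jratio -natr1; congr (_ / _); field.
  move: (n.+1%:R) NB rE d1C d2C => N NB rE d1C d2C.
  have N1 : 1 < N by move: NB; rewrite /B; lra.
  have N0 : 0 < N by lra.
  have r0 : 0 < jratio a n by rewrite rE divr_gt0//; move: g0; rewrite /g; lra.
  have eta1 : C / N ^+ 2 <= 1.
    rewrite ler_pdivrMr ?exprn_gt0// mul1r expr2.
    rewrite (@le_trans _ _ N)//; first by move: NB; rewrite /B; lra.
    by rewrite ler_peMr ?ltW.
  have := energy_step x1 d1C d2C eta1 rec (erefl (e n)).
  rewrite (_ : 6 / _ * _ = K / N ^+ 2); last by rewrite /K mulrA.
  rewrite (_ : _ + _ = jratio a n ^+ 2 * e n.+1); last by rewrite /e /p; ring.
  move=> step.
  rewrite -(ler_pM2l (exprn_gt0 2 r0)) (le_trans step)// mulrA ler_wpM2r//.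
  have rg : 1 + g / N <= jratio a n.
    rewrite rE -subr_ge0 /g.
    have -> : (N + a) / (N - 2^-1) - (1 + (a + 2^-1) / N) =
        g / (2 * N * (N - 2^-1)).
      by rewrite /g; field; rewrite !gt_eqF//; lra.
    by rewrite divr_ge0 ?mulr_ge0 ?(ltW g0)//; lra.
  have gN : 0 < g / N by rewrite divr_gt0.
  have gN1 : g / N <= 1 by rewrite ler_pdivrMr//; move: NB; rewrite /B; lra.
  have r2 : 1 + 2 * (g / N) <= jratio a n ^+ 2.
    rewrite (@le_trans _ _ ((1 + g / N) ^+ 2))//.
      by rewrite -subr_ge0 (_ : _ - _ = (g / N) ^+ 2) ?sqr_ge0//; ring.
    by rewrite ler_pXn2r ?nnegrE//; lra.
  apply: le_trans (_ : (1 + 2 * (g / N)) * (1 - g / N) <= _); last first.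
    by rewrite ler_wpM2r// subr_ge0.
  rewrite -subr_ge0.
  have -> : (1 + 2 * (g / N)) * (1 - g / N) - (1 + K / N ^+ 2) =
      g / N ^+ 2 * (N - (2 * g + K / g)).
    by field; rewrite !gt_eqF.
  rewrite mulr_ge0 ?divr_ge0 ?exprn_ge0 ?(ltW g0) ?(ltW N0)//.
  by move: NB; rewrite /B; lra.
have p2 : p n ^+ 2 @[n --> \oo] --> 0.
  apply: (@squeeze_cvgr _ _ _ _ (cst 0) (fun n => (1 - `|x|)^-1 * e n)).
  - by near=> n; rewrite sqr_ge0 /= mulrC ler_pdivlMr// mulrC.
  - exact: cvg_cst.
  - by rewrite -[X in _ --> X](mulr0 (1 - `|x|)^-1); apply: cvgMl_tmp.
apply/cvgr0Pnorm_lt => eps eps0.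
move/cvgr0Pnorm_lt : p2 => /(_ _ (exprn_gt0 2 eps0)); apply: filterS => n.
by rewrite normrX ltr_pXn2r ?nnegrE ?(ltW eps0).
Unshelve. all: by end_near. Qed.

(** Up to sign the value is (b+1)_n / (a+1)_n, whose successive quotients 1 - (a - b)/(a + 1 + n)
    again give harmonic decay. *)
Lemma njacobiN1_cvg0 a b : -1 < b -> b < a ->
  njacobi a b n (-1) @[n --> \oo] --> 0.
Proof.
move=> b1 ba; have a1 : -1 < a by apply: lt_trans ba.
pose e n := rising b n / rising a n.
have e0 n : 0 <= e n by rewrite divr_ge0// ltW// rising_gt0.
have ecv : e @ \oo --> 0.
  (* Chosen because a + 1 + n <= (1 + |a|)(n + 1). *)
  pose g := (a - b) / (1 + `|a|).
  have A0 : 0 < 1 + `|a| by rewrite ltr_pwDl.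
  apply: (@cvg0_of_harmonic_decay _ _ g 0%N) => //.
    by rewrite divr_gt0// subr_gt0.
  move=> n _; rewrite /e !risingS.
  have a0 : 0 < a + 1 + n%:R by rewrite ltr_wpDr//; lra.
  have ra : rising a n != 0 by rewrite gt_eqF// rising_gt0.
  rewrite (_ : _ / _ =
    (1 - (a - b) / (a + 1 + n%:R)) * (rising b n / rising a n)); last first.
    by field; rewrite ra gt_eqF.
  rewrite ler_wpM2r ?e0// lerD2l lerN2 /g -mulrA ler_wpM2l ?subr_ge0 ?(ltW ba)//.
  rewrite -invfM lef_pV2 ?posrE// ?mulr_gt0// -natr1.
  have := ler_norm a; have : 0 <= n%:R * `|a| by rewrite mulr_ge0.
  lra.
apply/cvgr0Pnorm_lt => eps eps0.
move/cvgr0Pnorm_lt : ecv => /(_ _ eps0); apply: filterS => n.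
by rewrite njacobiN1// normrMsign.
Qed.

Lemma njacobi_cvg_int a b x : - 2^-1 < a -> - 2^-1 <= b -> -1 < x <= 1 ->
  njacobi a b n x @[n --> \oo] --> ((x == 1)%:R : R).
Proof.
move=> a2 b2 /andP[xN1]; rewrite le_eqVlt => /predU1P[->|x1].
  have a1 : -1 < a by lra.
  have b1 : -1 < b by lra.
  by rewrite eqxx; under eq_fun do rewrite njacobi1//; exact: cvg_cst.
by rewrite lt_eqF//; apply: njacobi_cvg0; rewrite // ltr_norml xN1.
Qed.

Lemma njacobi_cvg a b x : - 2^-1 < a -> - 2^-1 <= b -> b < a -> -1 <= x <= 1 ->
  njacobi a b n x @[n --> \oo] --> ((x == 1)%:R : R).
Proof.
move=> a2 b2 ba /andP[]; rewrite le_eqVlt => /predU1P[<- _|xN1 x1].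
  rewrite (_ : (-1 == 1) = false); first by apply: njacobiN1_cvg0 => //; lra.
  by apply/eqP; lra.
by apply: njacobi_cvg_int; rewrite // xN1.
Qed.

(** For equal parameters the value at -1 is (-1)^n, which is constant on indices of one parity. *)
Lemma njacobi_cvg_parity a x (e : bool) (N : set nat) : - 2^-1 < a ->
  N `<=` [set k | odd k = e] -> -1 <= x <= 1 ->
  njacobi a a n x @[n --> within N \oo] -->
    ((x == 1)%:R + (-1) ^+ e * (x == -1)%:R : R).
Proof.
move=> a2 Ne /andP[]; rewrite le_eqVlt => /predU1P[<- _|xN1 x1].
  rewrite (_ : (-1 == 1) = false); last by apply/eqP; lra.
  rewrite eqxx add0r mulr1; apply: cvg_near_cst; rewrite near_withinE.
  near=> n => /Ne <-; have a1 : -1 < a by lra.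
  by rewrite njacobiN1// divff ?mulr1 ?signr_odd// gt_eqF// rising_gt0.
rewrite (gt_eqF xN1) mulr0 addr0; apply: cvg_trans (cvg_app _ (cvg_within _)) _.
by apply: njacobi_cvg_int; [|exact: ltW|rewrite xN1].
Unshelve. all: by end_near. Qed.

End JacobiDecay.

(** * Cayley-Dickson algebras and the geodesic distance *)

Section EuclideanDot.
Variable R : realType.

(** The Euclidean inner product of coordinate arrays, in which all the models of the spaces are
    expressed. *)
Definition mdot p q (x y : 'M[R]_(p, q)) : R := \sum_i \sum_j x i j * y i j.

Lemma enormE p q (x : 'M[R]_(p, q)) : enorm x = Num.sqrt (mdot x x).
Proof.
by rewrite /enorm; congr (Num.sqrt _); apply: eq_bigr => i _; apply: eq_bigr.
Qed.

Lemma dotvE d (x y : 'rV[R]_d) : dotv x y = mdot x y.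
Proof. by rewrite /mdot big_ord1. Qed.

Lemma mdot_row p q (x y : 'M[R]_(p, q)) :
  mdot x y = \sum_i mdot (row i x) (row i y).
Proof.
apply: eq_bigr => i _; rewrite /mdot big_ord1.
by apply: eq_bigr => j _; rewrite !mxE.
Qed.

Lemma mdotC p q (x y : 'M[R]_(p, q)) : mdot x y = mdot y x.
Proof. by apply: eq_bigr => i _; apply: eq_bigr => j _; rewrite mulrC. Qed.

Lemma mdotDl p q (x y z : 'M[R]_(p, q)) : mdot (x + y) z = mdot x z + mdot y z.
Proof.
rewrite -big_split; apply: eq_bigr => i _ /=; rewrite -big_split.
by apply: eq_bigr => j _; rewrite mxE mulrDl.
Qed.

Lemma mdotZl p q c (x y : 'M[R]_(p, q)) : mdot (c *: x) y = c * mdot x y.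
Proof.
rewrite mulr_sumr; apply: eq_bigr => i _; rewrite mulr_sumr.
by apply: eq_bigr => j _; rewrite mxE mulrA.
Qed.

Lemma mdotZr p q c (x y : 'M[R]_(p, q)) : mdot x (c *: y) = c * mdot x y.
Proof. by rewrite mdotC mdotZl mdotC. Qed.

Lemma mdotNl p q (x y : 'M[R]_(p, q)) : mdot (- x) y = - mdot x y.
Proof. by rewrite -scaleN1r mdotZl mulN1r. Qed.

Lemma mdotNr p q (x y : 'M[R]_(p, q)) : mdot x (- y) = - mdot x y.
Proof. by rewrite mdotC mdotNl mdotC. Qed.

Lemma mdotBB p q (x y : 'M[R]_(p, q)) :
  mdot (x - y) (x - y) = mdot x x - 2 * mdot x y + mdot y y.
Proof.
rewrite mdotDl mdotNl (mdotC x) (mdotC y) !mdotDl !mdotNl (mdotC y x).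
by ring.
Qed.

Lemma mdot_suml p q n (x : 'I_n -> 'M[R]_(p, q)) y :
  mdot (\sum_i x i) y = \sum_i mdot (x i) y.
Proof.
elim/big_ind2 : _ => [|? ? ? ? <- <-|//]; last by rewrite mdotDl.
by rewrite -(scale0r y) mdotZl mul0r.
Qed.

Lemma mdot_ge0 p q (x : 'M[R]_(p, q)) : 0 <= mdot x x.
Proof.
by apply: sumr_ge0 => i _; apply: sumr_ge0 => j _; rewrite -expr2 sqr_ge0.
Qed.

Lemma mdot_eq0 p q (x : 'M[R]_(p, q)) : mdot x x = 0 -> x = 0.
Proof.
have h i j : 0 <= x i j * x i j by rewrite -expr2 sqr_ge0.
move=> /eqP; rewrite psumr_eq0 => [|i _]; last exact: sumr_ge0.
move=> /allP H; apply/matrixP => i j; rewrite mxE.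
have := H i (mem_index_enum _); rewrite /= psumr_eq0// => /allP /(_ j).
by rewrite mem_index_enum => /(_ isT) /=; rewrite mulf_eq0 orbb => /eqP.
Qed.

Lemma unit_mdot_bound p q (x y : 'M[R]_(p, q)) :
  mdot x x = 1 -> mdot y y = 1 -> -1 <= mdot x y <= 1.
Proof.
move=> x1 y1; have := mdot_ge0 (x - y); have := mdot_ge0 (x - - y).
by rewrite !mdotBB mdotNl !mdotNr opprK x1 y1; lra.
Qed.

Lemma unit_mdot_eq1 p q (x y : 'M[R]_(p, q)) :
  mdot x x = 1 -> mdot y y = 1 -> mdot x y = 1 -> x = y.
Proof.
move=> x1 y1 xy; apply/eqP; rewrite -subr_eq0; apply/eqP/mdot_eq0.
by rewrite mdotBB x1 y1 xy; ring.
Qed.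

Lemma mdot_row_mx p n1 n2 (x1 y1 : 'M[R]_(p, n1)) (x2 y2 : 'M[R]_(p, n2)) :
  mdot (row_mx x1 x2) (row_mx y1 y2) = mdot x1 y1 + mdot x2 y2.
Proof.
rewrite -big_split; apply: eq_bigr => i _ /=; rewrite big_split_ord /=.
by congr (_ + _); apply: eq_bigr => j _; rewrite ?row_mxEl ?row_mxEr.
Qed.

Lemma mdot_scalar1 (a b : R) : mdot (a%:M : 'M[R]_1) (b%:M : 'M[R]_1) = a * b.
Proof. by rewrite /mdot !big_ord1 !mxE eqxx !mulr1n. Qed.

End EuclideanDot.

(** * Conjugation and real part under doubling *)

Section CayleyDickson.
Variable R : realType.

Lemma cd_mulE m (x y : 'rV[R]_(cd_dim m.+1)) :
  let a := lsubmx (x : 'rV[R]_(cd_dim m + cd_dim m)) in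
  let b := rsubmx (x : 'rV[R]_(cd_dim m + cd_dim m)) in
  let c := lsubmx (y : 'rV[R]_(cd_dim m + cd_dim m)) in
  let d := rsubmx (y : 'rV[R]_(cd_dim m + cd_dim m)) in
  cd_mul x y = row_mx (cd_mul a c - cd_mul (cd_conj d) b)
                      (cd_mul d a + cd_mul b (cd_conj c)).
Proof. by []. Qed.

Lemma cd_mul_row_mx m (a b c d : 'rV[R]_(cd_dim m)) :
  cd_mul (row_mx a b : 'rV[R]_(cd_dim m.+1)) (row_mx c d : 'rV[R]_(cd_dim m.+1)) =
  row_mx (cd_mul a c - cd_mul (cd_conj d) b)
         (cd_mul d a + cd_mul b (cd_conj c)) :> 'rV[R]_(cd_dim m.+1).
Proof. by rewrite cd_mulE !row_mxKl !row_mxKr. Qed.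

Lemma cd_conj_row_mx m (a b : 'rV[R]_(cd_dim m)) :
  cd_conj (row_mx a b : 'rV[R]_(cd_dim m.+1)) =
  row_mx (cd_conj a) (- b) :> 'rV[R]_(cd_dim m.+1).
Proof.
by rewrite [LHS](_ : _ = row_mx (cd_conj (lsubmx (row_mx a b)))
  (- rsubmx (row_mx a b)))// row_mxKl row_mxKr.
Qed.

Lemma cd_re_row_mx m (a b : 'rV[R]_(cd_dim m)) :
  cd_re (row_mx a b : 'rV[R]_(cd_dim m.+1)) = cd_re a.
Proof. by rewrite [LHS](_ : _ = cd_re (lsubmx (row_mx a b)))// row_mxKl. Qed.

Lemma cd_conjZ m (c : R) (x : 'rV[R]_(cd_dim m)) :
  cd_conj (c *: x) = c *: cd_conj x.
Proof.
elim: m x => [//|m IH] x; rewrite -[x]hsubmxK.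
rewrite (@cd_conj_row_mx m) (@scale_row_mx _ 1 (cd_dim m)) (@cd_conj_row_mx m).
by rewrite IH (@scale_row_mx _ 1 (cd_dim m)) scalerN.
Qed.

(** Both sides are proved together, because the doubling formula exchanges the order of some
    factors. *)
Lemma cd_mulZ m (c : R) (x y : 'rV[R]_(cd_dim m)) :
  cd_mul (c *: x) y = c *: cd_mul x y /\ cd_mul x (c *: y) = c *: cd_mul x y.
Proof.
elim: m x y => [|m IH] x y.
  have E (u v : 'rV[R]_(cd_dim 0)) : cd_mul u v = (u : 'M[R]_(1, 1)) *m v by [].
  by rewrite !E -scalemxAl -scalemxAr.
have IHl u v := (IH u v).1; have IHr u v := (IH u v).2.
rewrite -[x]hsubmxK -[y]hsubmxK.
move: (lsubmx x) (rsubmx x) (lsubmx y) (rsubmx y) => x1 x2 y1 y2.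
rewrite (scale_row_mx c x1 x2) (scale_row_mx c y1 y2) !(@cd_mul_row_mx m).
rewrite (@scale_row_mx _ 1 (cd_dim m) _ c (_ - _)) !cd_conjZ !IHl !IHr.
by rewrite scalerBr scalerDr.
Qed.

Lemma cd_conjN m (x : 'rV[R]_(cd_dim m)) : cd_conj (- x) = - cd_conj x.
Proof. by rewrite -scaleN1r cd_conjZ scaleN1r. Qed.

Lemma cd_mulN m (x y : 'rV[R]_(cd_dim m)) :
  cd_mul (- x) y = - cd_mul x y /\ cd_mul x (- y) = - cd_mul x y.
Proof.
rewrite -[- x]scaleN1r -[- y]scaleN1r.
by rewrite (cd_mulZ (-1) x y).1 (cd_mulZ (-1) x y).2 !scaleN1r.
Qed.

Lemma cd_reD m (x y : 'rV[R]_(cd_dim m)) : cd_re (x + y) = cd_re x + cd_re y.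
Proof.
elim: m x y => [|m IH] x y; first by rewrite /cd_re mxE.
rewrite -[x]hsubmxK -[y]hsubmxK (@add_row_mx _ 1 (cd_dim m)).
by rewrite !(@cd_re_row_mx m) IH.
Qed.

(** Induction on the doubling, without associativity; the octonions are included. *)
Lemma cd_re_mul_conj m (x y : 'rV[R]_(cd_dim m)) :
  cd_re (cd_mul (cd_conj x) y) = mdot x y /\
  cd_re (cd_mul x (cd_conj y)) = mdot x y.
Proof.
elim: m x y => [|m IH] x y.
  by rewrite /cd_re /cd_mul /cd_conj !mxE /mdot !big_ord1 mulrC.
have IHl u v := (IH u v).1; have IHr u v := (IH u v).2.
rewrite -[x]hsubmxK -[y]hsubmxK.
rewrite !(@cd_conj_row_mx m) !(@cd_mul_row_mx m) !(@cd_re_row_mx m).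
rewrite (@mdot_row_mx _ 1 (cd_dim m)) cd_conjN (cd_mulN _ _).1 (cd_mulN _ _).2.
by rewrite !opprK !cd_reD !IHl !IHr; split; rewrite // (mdotC (rsubmx y)).
Qed.

End CayleyDickson.

(** * Identities in R, C and H by real coordinates *)

Section DivisionRings.
Variable R : realType.

Definition quat1 (a : R) : 'rV[R]_(cd_dim 0) := a%:M.
Definition quat2 (a b : R) : 'rV[R]_(cd_dim 1) :=
  row_mx (quat1 a) (quat1 b).
Definition quat4 (a b c d : R) : 'rV[R]_(cd_dim 2) :=
  row_mx (quat2 a b) (quat2 c d).

Lemma quat1P (x : 'rV[R]_(cd_dim 0)) : exists a, x = quat1 a.
Proof. by exists (x 0 0); exact: mx11_scalar. Qed.

Lemma quat2P (x : 'rV[R]_(cd_dim 1)) : exists a b, x = quat2 a b.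
Proof.
have [a xa] := quat1P (@lsubmx R 1 (cd_dim 0) (cd_dim 0) x).
have [b xb] := quat1P (@rsubmx R 1 (cd_dim 0) (cd_dim 0) x).
by exists a, b; rewrite /quat2 -xa -xb hsubmxK.
Qed.

Lemma quat4P (x : 'rV[R]_(cd_dim 2)) : exists a b c d, x = quat4 a b c d.
Proof.
have [a [b xa]] := quat2P (@lsubmx R 1 (cd_dim 1) (cd_dim 1) x).
have [c [d xb]] := quat2P (@rsubmx R 1 (cd_dim 1) (cd_dim 1) x).
by exists a, b, c, d; rewrite /quat4 -xa -xb hsubmxK.
Qed.

Lemma quat1_conj a : cd_conj (quat1 a) = quat1 a.
Proof. by []. Qed.

Lemma quat1_mul a b : cd_mul (quat1 a) (quat1 b) = quat1 (a * b).
Proof. by rewrite /quat1 scalar_mxM. Qed.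

Lemma quat1D a b : quat1 a + quat1 b = quat1 (a + b).
Proof. by rewrite /quat1 raddfD. Qed.

Lemma quat1N a : - quat1 a = quat1 (- a).
Proof. by rewrite /quat1 raddfN. Qed.

Lemma quat1_dot a b : mdot (quat1 a) (quat1 b) = a * b.
Proof. exact: mdot_scalar1. Qed.

Lemma quat2D a b c d : quat2 a b + quat2 c d = quat2 (a + c) (b + d).
Proof. by rewrite /quat2 (@add_row_mx _ 1 (cd_dim 0)) !quat1D. Qed.

Lemma quat2N a b : - quat2 a b = quat2 (- a) (- b).
Proof. by rewrite /quat2 (@opp_row_mx _ 1 (cd_dim 0)) !quat1N. Qed.

Lemma quat2_conj a b : cd_conj (quat2 a b) = quat2 a (- b).
Proof. by rewrite /quat2 (@cd_conj_row_mx _ 0) quat1_conj quat1N. Qed.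

Lemma quat2_mul a b c d :
  cd_mul (quat2 a b) (quat2 c d) = quat2 (a * c - d * b) (d * a + b * c).
Proof.
by rewrite /quat2 (@cd_mul_row_mx _ 0) !quat1_conj !quat1_mul quat1N !quat1D.
Qed.

Lemma quat2_dot a b c d : mdot (quat2 a b) (quat2 c d) = a * c + b * d.
Proof. by rewrite (@mdot_row_mx _ 1 (cd_dim 0)) !quat1_dot. Qed.

Lemma quat4_conj a b c d : cd_conj (quat4 a b c d) = quat4 a (- b) (- c) (- d).
Proof. by rewrite /quat4 (@cd_conj_row_mx _ 1) quat2_conj quat2N. Qed.

Lemma quat4_mul a b c d a' b' c' d' :
  cd_mul (quat4 a b c d) (quat4 a' b' c' d') =
  quat4 (a * a' - b' * b - (c' * c + d' * d))
        (b' * a + b * a' - (d * c' - d' * c))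
        (c' * a - b * d' + (c * a' + b' * d))
        (b * c' + d' * a + (d * a' - b' * c)).
Proof.
rewrite /quat4 (@cd_mul_row_mx _ 1) !quat2_conj !quat2_mul quat2N !quat2D.
by congr (row_mx (quat2 _ _) (quat2 _ _)); ring.
Qed.

Lemma quat4_dot a b c d a' b' c' d' :
  mdot (quat4 a b c d) (quat4 a' b' c' d') = a * a' + b * b' + c * c' + d * d'.
Proof. by rewrite (@mdot_row_mx _ 1 (cd_dim 1)) !quat2_dot addrA. Qed.

Variable K : division_ring.
Local Notation kV := 'rV[R]_(cd_dim (level K)).

(** A polynomial identity in coordinates. It makes [kscale v (kdot v w)], for a unit vector v, the
    orthogonal projection of w on the line of v. *)
Lemma cd_mul_adjoint (v w a : kV) :
  mdot w (cd_mul v a) = mdot (cd_mul (cd_conj v) w) a.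
Proof.
case: K v w a => /= v w a.
- have [[? ->] [? ->] [? ->]] := And3 (quat1P v) (quat1P w) (quat1P a).
  by rewrite quat1_conj !quat1_mul !quat1_dot; ring.
- have [[? [? ->]] [? [? ->]] [? [? ->]]] := And3 (quat2P v) (quat2P w) (quat2P a).
  by rewrite quat2_conj !quat2_mul !quat2_dot; ring.
- have [[? [? [? [? ->]]]] [? [? [? [? ->]]]] [? [? [? [? ->]]]]] :=
    And3 (quat4P v) (quat4P w) (quat4P a).
  by rewrite quat4_conj !quat4_mul !quat4_dot; ring.
Qed.

(** For C and H these are the two-square and four-square identities. *)
Lemma mdot_cd_mul (v a : kV) :
  mdot (cd_mul v a) (cd_mul v a) = mdot v v * mdot a a.
Proof.
case: K v a => /= v a.
- have [[? ->] [? ->]] := conj (quat1P v) (quat1P a).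
  by rewrite !quat1_mul !quat1_dot; ring.
- have [[? [? ->]] [? [? ->]]] := conj (quat2P v) (quat2P a).
  by rewrite !quat2_mul !quat2_dot; ring.
- have [[? [? [? [? ->]]]] [? [? [? [? ->]]]]] := conj (quat4P v) (quat4P a).
  by rewrite !quat4_mul !quat4_dot; ring.
Qed.

Lemma cd_mulA (v w a : kV) : cd_mul (cd_mul v w) a = cd_mul v (cd_mul w a).
Proof.
case: K v w a => /= v w a.
- have [[? ->] [? ->] [? ->]] := And3 (quat1P v) (quat1P w) (quat1P a).
  by rewrite !quat1_mul; congr quat1; ring.
- have [[? [? ->]] [? [? ->]] [? [? ->]]] := And3 (quat2P v) (quat2P w) (quat2P a).
  by rewrite !quat2_mul; congr quat2; ring.
- have [[? [? [? [? ->]]]] [? [? [? [? ->]]]] [? [? [? [? ->]]]]] :=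
    And3 (quat4P v) (quat4P w) (quat4P a).
  by rewrite !quat4_mul; congr quat4; ring.
Qed.

Lemma cd_mul_conjr (a : kV) :
  mdot a a = 1 -> cd_mul a (cd_conj a) = cd_one R (level K).
Proof.
have q2 : cd_one R 1 = quat2 1 0 by rewrite /quat2 /quat1 raddf0.
have q4 : cd_one R 2 = quat4 1 0 0 0.
  by rewrite /quat4 -q2 /quat2 /quat1 raddf0 row_mx0.
case: K a => /= a.
- have [x ->] := quat1P a.
  by rewrite quat1_dot quat1_conj quat1_mul => ->.
- have [x [y ->]] := quat2P a; rewrite quat2_dot quat2_conj quat2_mul q2 => <-.
  by congr quat2; ring.
- have [x [y [z [t ->]]]] := quat4P a.
  rewrite quat4_dot quat4_conj quat4_mul q4 => <-.
  by congr quat4; ring.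
Qed.

End DivisionRings.

Section CayleyOne.
Variable R : realType.

Lemma cd_mulr1 m (x : 'rV[R]_(cd_dim m)) : cd_mul x (cd_one R m) = x.
Proof.
elim: m x => [|m IH] x; first exact: mulmx1.
rewrite -[x]hsubmxK (_ : cd_one R m.+1 = row_mx (cd_one R m) 0)//.
rewrite (@cd_mul_row_mx _ m) cd_conj0 !(cd_mul0l _).1 cd_conj1 !IH.
by rewrite subr0 add0r.
Qed.

Lemma mdot_cd_one m : mdot (cd_one R m) (cd_one R m) = 1.
Proof.
elim: m => [|m IH]; first by rewrite [LHS]mdot_scalar1 mulr1.
rewrite (_ : cd_one R m.+1 = row_mx (cd_one R m) 0)//.
by rewrite (@mdot_row_mx _ 1 (cd_dim m)) IH -(scale0r 0) mdotZl mul0r addr0.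
Qed.

End CayleyOne.

(** * The cosine of the distance separates points *)

Section Distances.
Variable R : realType.

Section Lines.
Variables (K : division_ring) (p : nat).
Implicit Types (v w : kvec R K p) (a b : 'rV[R]_(cd_dim (level K))).

Lemma row_kscale v a i : row i (kscale v a) = cd_mul (row i v) a.
Proof. by apply/rowP => j; rewrite !mxE. Qed.

Lemma kscaleA v a b : kscale (kscale v a) b = kscale v (cd_mul a b).
Proof. by apply/row_matrixP => i; rewrite !row_kscale cd_mulA. Qed.

Lemma kscale1 v : kscale v (cd_one R (level K)) = v.
Proof. by apply/row_matrixP => i; rewrite row_kscale cd_mulr1. Qed.

Lemma kscale_scale (c : R) v a : kscale (c *: v) a = kscale v (c *: a).
Proof.
apply/row_matrixP => i; rewrite !row_kscale (cd_mulZ c (row i v) a).2.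
by rewrite -(cd_mulZ c (row i v) a).1; congr cd_mul; apply/rowP => j; rewrite !mxE.
Qed.

Lemma kline_scale (c : R) v : c != 0 -> kline (c *: v) = kline v.
Proof.
move=> c0; apply/seteqP; split => w [a ->].
  by exists (c *: a); rewrite kscale_scale.
by exists (c^-1 *: a); rewrite kscale_scale scalerA divff// scale1r.
Qed.

Lemma mdot_kscale_r w v a : mdot w (kscale v a) = mdot (kdot v w) a.
Proof.
rewrite mdot_row /kdot mdot_suml; apply: eq_bigr => i _.
by rewrite row_kscale cd_mul_adjoint.
Qed.

Lemma mdot_kscale v a :
  mdot (kscale v a) (kscale v a) = mdot v v * mdot a a.
Proof.
rewrite mdot_row [mdot v v]mdot_row mulr_suml; apply: eq_bigr => i _.
by rewrite row_kscale mdot_cd_mul.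
Qed.

(** Pythagoras for w and its projection on the line of v. Cauchy-Schwarz and its equality case
    follow. *)
Lemma mdot_kproj v w : mdot v v = 1 -> mdot w w = 1 ->
  mdot (w - kscale v (kdot v w)) (w - kscale v (kdot v w)) =
  1 - mdot (kdot v w) (kdot v w).
Proof.
by move=> v1 w1; rewrite mdotBB mdot_kscale_r mdot_kscale v1 w1; ring.
Qed.

Lemma kdot_le1 v w : mdot v v = 1 -> mdot w w = 1 ->
  mdot (kdot v w) (kdot v w) <= 1.
Proof.
by move=> v1 w1; rewrite -subr_ge0 -mdot_kproj//; exact: mdot_ge0.
Qed.

Lemma kdot_self v : mdot v v = 1 -> mdot (kdot v v) (kdot v v) = 1.
Proof.
move=> v1; apply/eqP; rewrite eq_le kdot_le1//=.
(* The component of [kdot v v] along 1 is |v|^2 = 1, so its norm is at least 1. *)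
have := mdot_ge0 (kdot v v - cd_one R (level K)).
by rewrite mdotBB -(mdot_kscale_r _ _ (cd_one _ _)) kscale1 v1 mdot_cd_one; lra.
Qed.

(** The residual of the projection vanishes, so w = v a with |a| = 1, and the conjugate of a leads
    back from w to v. *)
Lemma kdot_eq1 v w : mdot v v = 1 -> mdot w w = 1 ->
  mdot (kdot v w) (kdot v w) = 1 -> kline v = kline w.
Proof.
move=> v1 w1 vw; set a := kdot v w in vw.
have wE : w = kscale v a.
  apply/eqP; rewrite -subr_eq0; apply/eqP/mdot_eq0.
  by rewrite mdot_kproj// vw subrr.
have vE : v = kscale w (cd_conj a) by rewrite wE kscaleA cd_mul_conjr// kscale1.
apply/seteqP; split => z [b ->].
  by exists (cd_mul (cd_conj a) b); rewrite [in LHS]vE kscaleA.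
by exists (cd_mul a b); rewrite [in LHS]wE kscaleA.
Qed.

End Lines.

Lemma krepP K p (L : set (kvec R K p)) :
  (exists v, v != 0 /\ L = kline v) -> krep L != 0 /\ L = kline (krep L).
Proof.
by move=> LP; rewrite /krep; case: xgetP => // /(_ _ _) H; case: LP => v /H.
Qed.

Lemma mdot_normalize p q (v : 'M[R]_(p, q)) : v != 0 ->
  enorm v != 0 /\ mdot ((enorm v)^-1 *: v) ((enorm v)^-1 *: v) = 1.
Proof.
move=> v0; have vv : 0 < mdot v v.
  by rewrite lt_def mdot_ge0 andbT; apply: contra_neq v0 => /mdot_eq0.
have e0 : enorm v != 0 by rewrite enormE gt_eqF// sqrtr_gt0.
split=> //; rewrite mdotZl mdotZr mulrA -invfM -expr2.
by rewrite enormE sqr_sqrtr ?mulVf ?gt_eqF// ltW.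
Qed.

(** The double angle formula; for the projective distances u is a squared modulus. *)
Lemma cos_2acos_sqrt (u : R) : 0 <= u <= 1 ->
  cos (2 * acos (Num.sqrt u)) = 2 * u - 1.
Proof.
move=> /andP[u0 u1]; rewrite mulr_natl cos_mulr2n acosK.
  by rewrite sqr_sqrtr// mulr_natl.
rewrite in_itv/= (le_trans _ (sqrtr_ge0 u)) ?lerN10//=.
by rewrite -sqrtr1 ler_wsqrtr.
Qed.

Lemma cos_2acos_sqrt_eq1 (u : R) : 0 <= u <= 1 ->
  (cos (2 * acos (Num.sqrt u)) = 1) <-> (u = 1).
Proof.
by move=> u01; rewrite cos_2acos_sqrt//; split => [|->]; [lra|ring].
Qed.

(** For Hermitian Y each term is the real part of X_ij conj(Y_ij), the inner product of two
    entries. *)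
Lemma otraceE (X Y : omat R) :
  (forall i j, oentry Y j i = cd_conj (oentry Y i j)) -> otrace X Y = mdot X Y.
Proof.
move=> hY; rewrite /otrace mdot_row pair_big /=.
rewrite [RHS](reindex (uncurry (@mxvec_index 3 3))) /=; last first.
  exact: curry_mxvec_bij.
by apply: eq_bigr => -[i j] _ /=; rewrite hY (cd_re_mul_conj _ _).2.
Qed.

(** |X|^2 = Re tr(X^2) = Re tr X = 1. *)
Lemma otrace_self (X : omat R) : oprojection X -> mdot X X = 1.
Proof.
move=> [hX idX trX]; rewrite -otraceE// -trX; apply: eq_bigr => i _.
rewrite -idX; elim/big_ind2 : _ => [|? ? ? ? -> ->|//]; last by rewrite cd_reD.
by rewrite cd_re0.
Qed.

(** In each model, cosine 1 is the equality case of Cauchy-Schwarz for unit representatives. *)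
Lemma cos_gdist_eq1 M (x y : mfd R M) : (cos (gdist x y) = 1) <-> (x = y).
Proof.
case: M x y => [d d3|K n n2|] x y /=.
- have x1 := svalP x; have y1 := svalP y; rewrite !dotvE in x1 y1.
  rewrite acosK ?in_itv/= dotvE ?unit_mdot_bound//.
  split=> [/(unit_mdot_eq1 x1 y1)|->//].
  by case: x y {x1 y1} => [x ?] [y ?] /= ?; exact: eq_exist.
- have [v0 xE] := krepP (svalP x); have [w0 yE] := krepP (svalP y).
  have [nv v1] := mdot_normalize v0; have [nw w1] := mdot_normalize w0.
  rewrite enormE cos_2acos_sqrt_eq1 ?mdot_ge0 ?kdot_le1//.
  split=> [/(kdot_eq1 v1 w1)|xy]; last by rewrite xy kdot_self// -xy.
  rewrite !kline_scale ?invr_eq0// -xE -yE.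
  by case: x y {v0 w0 xE yE nv v1 nw w1} => [x ?] [y ?] /= ?; exact: eq_exist.
- have [hX _ _] := svalP x; have [hY _ _] := svalP y.
  have x1 := otrace_self (svalP x); have y1 := otrace_self (svalP y).
  rewrite otraceE//; have /andP[_ le1] := unit_mdot_bound x1 y1.
  have [m0|m0] := leP 0 (mdot (sval x) (sval y)).
    rewrite cos_2acos_sqrt_eq1 ?m0//.
    split=> [/(unit_mdot_eq1 x1 y1)|->//].
    by case: x y {hX hY x1 y1 le1 m0} => [x ?] [y ?] /= ?; exact: eq_exist.
  (* [Num.sqrt] is 0 on negative numbers, so the cosine is -1 here, while x = y would force the
     inner product to be 1. *)
  have -> : Num.sqrt (mdot (sval x) (sval y)) = Num.sqrt 0.
    by rewrite sqrtr0 ltr0_sqrtr.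
  rewrite cos_2acos_sqrt ?lexx ?ler01// mulr0 sub0r; split=> [|xy].
    by move=> n1; exfalso; move: n1; lra.
  by move: m0; rewrite xy y1; lra.
Qed.

End Distances.

(** * Limits of quadratic forms *)

Section Limits.

(** An N that is eventually empty is bounded, hence finite. Properness makes limits along N
    unique. *)
Lemma within_infinite_proper (N : set nat) :
  infinite_set N -> ProperFilter (within N \oo).
Proof.
move=> Ninf; split; last exact: within_filter.
rewrite /within => -[n _ nN]; apply: Ninf; apply: sub_finite_set (finite_II n).
by move=> k Nk; rewrite /= ltnNge; apply/negP => /nN /(_ Nk).
Qed.

Variable C : numFieldType.

Lemma cvg_sumo (T I : Type) (F : set_system T) (s : seq I) (u : I -> T -> C^o)
    (l : I -> C^o) : Filter F ->
  (forall i, u i t @[t --> F] --> l i) ->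
  (\sum_(i <- s) u i t) @[t --> F] --> \sum_(i <- s) l i.
Proof.
move=> FF ul; elim: s => [|i s IH].
  rewrite big_nil; under eq_fun do rewrite big_nil; exact: cvg_cst.
rewrite big_cons; under eq_fun do rewrite big_cons.
by apply: cvgD.
Qed.

Lemma cvg_form (T : Type) (F : set_system T) n (z c : 'I_n -> C)
    (H : T -> 'I_n -> 'I_n -> C) (L : 'I_n -> 'I_n -> C) : Filter F ->
  (forall i l, (H t i l : C^o) @[t --> F] --> (L i l : C^o)) ->
  (\sum_i \sum_l z i * H t i l * c l : C^o) @[t --> F] -->
  (\sum_i \sum_l z i * L i l * c l : C^o).
Proof.
move=> FF HL; apply: cvg_sumo => i; apply: cvg_sumo => l.
by apply: (@cvgMr_tmp C); apply: (@cvgMl_tmp C).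
Qed.

(** All partial sums past a positive term [u k] are at least [u k]. *)
Lemma sum_cvg0_eq0 (u : nat -> C) : (forall k, 0 <= u k) ->
  (\sum_(0 <= k < n) u k : C^o) @[n --> \oo] --> (0 : C^o) ->
  forall k, u k = 0.
Proof.
move=> u0 /cvgr0_norm_lt ucv k; apply: contrapT => /eqP uk.
have uk0 : 0 < u k by rewrite lt_def uk u0.
have [n _ /(_ (maxn n k.+1))] := ucv _ uk0.
rewrite /= leq_maxl => /(_ isT); rewrite ger0_norm ?sumr_ge0// => /lt_geF.
rewrite (@big_cat_nat _ _ _ k.+1) ?leq_maxr//= big_nat_recr//=.
by rewrite -addrA addrCA lerDl addr_ge0 ?sumr_ge0.
Qed.

End Limits.

Section ComplexLimits.
Variable R : realType.

Lemma cvg_real_complex (T : Type) (F : set_system T) (u : T -> R) (l : R) :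
  Filter F -> u @ F --> l ->
  ((u t)%:C : R[i]^o) @[t --> F] --> (l%:C : R[i]^o).
Proof.
move=> FF /cvgrPdist_lt ul; apply/cvgrPdist_lt => e e0.
(* A positive element of [R[i]] is real, so the radius comes from R. *)
have eE : e = (complex.Re e)%:C by rewrite RRe_real// gtr0_real.
have e0' : 0 < complex.Re e by rewrite -ltcR -eE.
apply: filterS (ul _ e0') => t.
by rewrite -raddfB eE normc_def /= expr0n /= addr0 sqrtr_sqr ltcR.
Qed.

End ComplexLimits.

(** * The parameters alpha and beta of the spaces *)

Section SpaceConstants.
Variables (R : realType) (M : two_point_space).
Local Notation a := (mfd_alpha R M).
Local Notation b := (mfd_beta R M).

Lemma mfd_alpha_gt : - 2^-1 < a.
Proof.
have : (3 <= mfd_d M)%N.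
  case: M => [//|K n n2|//]; rewrite /mfd_d ltnS.
  by rewrite (leq_trans n2)// leq_pmulr// cd_dim_gt0.
by rewrite -(ler_nat R) /mfd_alpha; lra.
Qed.

Lemma mfd_beta_ge : - 2^-1 <= b.
Proof.
case: M => [d d3|[] n n2|] /=; try lra.
by move: d3; rewrite -(ler_nat R); lra.
Qed.

(** With q = dim K, a projective space has beta = q/2 - 1 and alpha = nq/2 - 1, where n >= 2; the
    Cayley plane has 3 and 7. *)
Lemma mfd_beta_lt : ~~ is_sphere M -> b < a.
Proof.
case: M => [//|K n n2|] _; rewrite /mfd_alpha /mfd_beta /mfd_d; last by lra.
rewrite -[(n * _).+1%:R]natr1 natrM; move: n2; rewrite -(ler_nat R).
case: K; [rewrite (_ : cd_dim _ = 1%N)//|rewrite (_ : cd_dim _ = 2%N)//|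
  rewrite (_ : cd_dim _ = 4%N)//]; lra.
Qed.

Lemma mfd_beta_sphere : is_sphere M -> b = a.
Proof. by case: M. Qed.

Lemma mfd_jacobi_ratio k x :
  (mfd_jacobi R M k).[x] / (mfd_jacobi R M k).[1] = njacobi a b k x.
Proof.
by rewrite njacobiE//; have := mfd_alpha_gt; have := mfd_beta_ge; lra.
Qed.

Lemma mfd_jacobi_at1_gt0 k : 0 < (mfd_jacobi R M k).[1].
Proof.
by apply: jacobi_at1_gt0; have := mfd_alpha_gt; have := mfd_beta_ge; lra.
Qed.

End SpaceConstants.

(** * Vanishing forms and their limits along the index set *)

Section StrictPositivity.
Variables (R : realType) (M : two_point_space).
Variables (m : nat -> nat) (f : forall k, 'I_(m k) -> mfd R M -> R[i]).
Arguments f : clear implicits.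

(* If c_k = 0, the addition formula on the diagonal makes every f_{j,k} vanish,
   against orthonormality; the values of Gamma are not needed. *)
Lemma mfd_c_neq0 (mu : probability (borel_mfd R M) R) lam k :
  eigen_basis mu f lam -> addition_formula f -> mfd_c R M k != 0.
Proof.
move=> fB add; apply/eqP => c0.
pose j := Ordinal (eigen_mult_gt0 fB k).
have f0 x : f k j x = 0.
  apply/eqP; move/eqP: (add k x x); rewrite c0 mul0r psumr_eq0 => [|i _].
    move=> /allP /(_ j (mem_index_enum _)) /=.
    by rewrite mulf_eq0 conjc_eq0 orbb.
  exact: mulcJ_ge0.
have := eigen_orthonormal fB j j; rewrite eqxx /L2dot.
have -> : (fun x => complex.Re (f k j x * (f k j x)^*)) = cst 0.
  by apply/funext => x; rewrite f0 mul0r.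
have -> : (fun x => complex.Im (f k j x * (f k j x)^*)) = cst 0.
  by apply/funext => x; rewrite f0 mul0r.
rewrite Rintegral_cst//= mul0r => /eqP.
by rewrite eq_sym oner_eq0.
Qed.

Variables (n : nat) (c : 'I_n -> R[i]) (x : 'I_n -> mfd R M).

Definition qform (H : 'I_n -> 'I_n -> R[i]) : R[i] :=
  \sum_i \sum_l (c i)^* * H i l * c l.

Lemma qform_sum (I : Type) (s : seq I) (P : pred I)
    (H : I -> 'I_n -> 'I_n -> R[i]) :
  qform (fun i l => \sum_(j <- s | P j) H j i l) =
  \sum_(j <- s | P j) qform (H j).
Proof.
rewrite /qform.
under eq_bigr do under eq_bigr do rewrite mulr_sumr mulr_suml.
under eq_bigr do rewrite exchange_big.
by rewrite exchange_big.
Qed.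

Lemma qformZ (w : R[i]) (H : 'I_n -> 'I_n -> R[i]) :
  qform (fun i l => w * H i l) = w * qform H.
Proof.
rewrite mulr_sumr; apply: eq_bigr => i _; rewrite mulr_sumr.
by apply: eq_bigr => l _; ring.
Qed.

Lemma qformD (G H : 'I_n -> 'I_n -> R[i]) :
  qform (fun i l => G i l + H i l) = qform G + qform H.
Proof.
rewrite -big_split; apply: eq_bigr => i _; rewrite -big_split.
by apply: eq_bigr => l _ /=; ring.
Qed.

Definition evalsum (g : mfd R M -> R[i]) : R[i] := \sum_i (c i)^* * g (x i).

(* [%R] selects [Num.conj], as in the definition of the kernels, instead of
   [conjc]. *)
Lemma qform_rank1 (g : mfd R M -> R[i]) :
  qform (fun i l => g (x i) * (g (x l))^*) =
  (evalsum g * (evalsum g)^*)%R.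
Proof.
have -> : ((evalsum g)^* = \sum_l c l * (g (x l))^*)%R.
  rewrite /evalsum rmorph_sum; apply: eq_bigr => l _.
  by rewrite rmorphM; congr (_ * _); exact: conjCK.
rewrite mulr_suml; apply: eq_bigr => i _; rewrite mulr_sumr.
by apply: eq_bigr => l _; ring.
Qed.

Lemma qform_delta : injective x ->
  qform (fun i l => (cos (gdist (x i) (x l)) == 1)%:R) = \sum_i `|c i| ^+ 2.
Proof.
move=> xI; apply: eq_bigr => i _; rewrite (bigD1 i)//= big1 => [|l li].
  have -> : cos (gdist (x i) (x i)) = 1 by apply/cos_gdist_eq1.
  by rewrite eqxx mulr1 addr0 normCK mulrC.
have /negbTE -> : cos (gdist (x i) (x l)) != 1.
  by apply: contra_neq li => /cos_gdist_eq1 /xI ->.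
by rewrite mulr0 mul0r.
Qed.

(** The form of K is the sum of the series of d_{j,k} |[evalsum (f k j)]|^2, whose terms are
    nonnegative. *)
Lemma evalsum_eq0 (d : forall k, 'I_(m k) -> R) (K : mfd R M -> mfd R M -> R[i]) :
  (forall k j, 0 <= d k j) -> has_expansion f d K -> kernel_form K x c = 0 ->
  forall k j, 0 < d k j -> evalsum (f k j) = 0.
Proof.
move=> d0 fdK K0.
have t0 k j : 0 <= (d k j)%:C * (evalsum (f k j) * (evalsum (f k j))^*)%R.
  by rewrite mulr_ge0 ?ler0c// mul_conjC_ge0.
have u0 k : 0 <= \sum_j (d k j)%:C * (evalsum (f k j) * (evalsum (f k j))^*)%R.
  by apply: sumr_ge0 => j _.
have E N : \sum_(0 <= k < N) \sum_j
      (d k j)%:C * (evalsum (f k j) * (evalsum (f k j))^*)%R =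
    qform (fun i l =>
      \sum_(0 <= k < N) \sum_j (d k j)%:C * f k j (x i) * (f k j (x l))^*).
  rewrite qform_sum; apply: eq_bigr => k _; rewrite qform_sum.
  apply: eq_bigr => j _; rewrite -qform_rank1 -qformZ; congr qform.
  by apply/funext => i; apply/funext => l; rewrite mulrA.
have cv : (qform (fun i l => \sum_(0 <= k < N) \sum_j
      (d k j)%:C * f k j (x i) * (f k j (x l))^*) : R[i]^o)
    @[N --> \oo] --> (kernel_form K x c : R[i]^o).
  by apply: cvg_form => i l; exact: fdK.
rewrite K0 -(funext E) in cv.
move=> k j dkj.
have /eqP := sum_cvg0_eq0 u0 cv k; rewrite psumr_eq0 => [|i _]; last exact: t0.
move=> /allP /(_ j (mem_index_enum _)) /=.
rewrite mulf_eq0 mul_conjC_eq0 => /orP[|/eqP//].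
by rewrite (inj_eq (@complexI _) _ 0) gt_eqF.
Qed.

Hypothesis add : addition_formula f.
Variables (N : set nat) (A : forall k, {set 'I_(m k)}).
Arguments A : clear implicits.

(** Along N' the forms of p_k(cos d(x_i, x_l)) converge to the form of h. By the addition formula
    and [ev0] they equal the normalized forms over the complement of A_k, which tend to 0. *)
Lemma qform_limit (N' : set nat) (h : R -> R) :
  (forall k, mfd_c R M k != 0) ->
  (forall x y : mfd R M,
    (((mfd_c R M k)^-1)%:C * (\sum_(j in ~: A k) f k j x * (f k j y)^*)
       / ((mfd_jacobi R M k).[1])%:C : R[i]^o)
      @[k --> within N \oo] --> (0 : R[i]^o)) ->
  N' `<=` N -> infinite_set N' ->
  (forall t, -1 <= t <= 1 ->
    njacobi (mfd_alpha R M) (mfd_beta R M) k t @[k --> within N' \oo] --> h t) ->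
  (forall k j, N k -> j \in A k -> evalsum (f k j) = 0) ->
  qform (fun i l => (h (cos (gdist (x i) (x l))))%:C) = 0.
Proof.
move=> c0 lim0 N'N N'inf hP ev0.
have PF := within_infinite_proper N'inf.
have cv1 : (qform (fun i l => (njacobi (mfd_alpha R M) (mfd_beta R M) k
      (cos (gdist (x i) (x l))))%:C) : R[i]^o) @[k --> within N' \oo] -->
    (qform (fun i l => (h (cos (gdist (x i) (x l))))%:C) : R[i]^o).
  apply: cvg_form => i l; apply: cvg_real_complex.
  by apply: hP; rewrite cos_geN1 cos_le1.
have cv2 : (qform (fun i l => ((mfd_c R M k)^-1)%:C *
      (\sum_(j in ~: A k) f k j (x i) * (f k j (x l))^*)
       / ((mfd_jacobi R M k).[1])%:C) : R[i]^o) @[k --> within N' \oo] -->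
    (qform (fun i l => 0) : R[i]^o).
  apply: cvg_form => i l; apply: cvg_trans (lim0 (x i) (x l)).
  by apply: cvg_app; apply: within_subset.
have <- : qform (fun i l => 0) = 0.
  rewrite /qform big1// => i _; rewrite big1// => l _.
  by rewrite mulr0 mul0r.
apply: (cvg_unique (@norm_hausdorff _ _) cv1).
apply: cvg_trans cv2; apply: near_eq_cvg; rewrite near_withinE; near=> k => N'k.
pose w := ((mfd_c R M k)^-1)%:C / ((mfd_jacobi R M k).[1])%:C.
transitivity (w * qform (fun i l =>
    \sum_(j in ~: A k) f k j (x i) * (f k j (x l))^*)).
  rewrite -qformZ; congr qform; apply/funext => i; apply/funext => l.
  by rewrite /w mulrAC.
(* The indices j in A_k may be added, since each contributes |[evalsum (f k j)]|^2 = 0. *)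
transitivity (w * qform (fun i l => \sum_j f k j (x i) * (f k j (x l))^*)).
  congr (w * _); rewrite !qform_sum [RHS](bigID (mem (~: A k))) /=.
  rewrite [X in _ = _ + X]big1 ?addr0// => j.
  by rewrite inE negbK => jA; rewrite qform_rank1 ev0 ?mul0r//; exact: N'N.
rewrite -qformZ; congr qform; apply/funext => i; apply/funext => l.
rewrite add -mfd_jacobi_ratio /w -fmorphV -!rmorphM; congr (_%:C).
by field; rewrite c0 gt_eqF ?mfd_jacobi_at1_gt0.
Unshelve. all: by end_near. Qed.

End StrictPositivity.

(** * Strict positive definiteness, with the sphere split by parity *)

Theorem theorem3p2 (R : realType) (M : two_point_space)
    (mu : probability (borel_mfd R M) R)
    (lam : nat -> R) (m : nat -> nat)
    (f : forall k, 'I_(m k) -> mfd R M -> R[i])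
    (N : set nat) (A : forall k, {set 'I_(m k)}) :
  isometry_invariant mu ->
  eigen_basis mu f lam ->
  addition_formula f ->
  infinite_set N ->
  (forall x y : mfd R M,
    (((mfd_c R M k)^-1)%:C * (\sum_(j in ~: A k) f k j x * (f k j y)^*)
       / ((mfd_jacobi R M k).[1])%:C : R[i]^o)
      @[k --> within N \oo] --> (0 : R[i]^o)) ->
  (is_sphere M ->
    infinite_set (N `&` [set k | ~~ odd k]) /\
    infinite_set (N `&` [set k | odd k])) ->
  induces_strict_positive_definiteness f
    [set p : {k : nat & 'I_(m k)} | N (tag p) /\ tagged p \in A (tag p)].
Proof.
move=> _ fB add Ninf lim0 sph d K d0 dF fdK _ [Kherm Kpd].
split=> // n x xI c [i0 ci0].
rewrite lt_def Kpd// andbT; apply/eqP => K0.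
have ev0 k (j : 'I_(m k)) : N k -> j \in A k -> evalsum c x (f k j) = 0.
  move=> Nk jA; apply: (evalsum_eq0 d0 fdK K0).
  have : [set p : {k : nat & 'I_(m k)} | 0 < d (tag p) (tagged p)] (existT _ k j).
    by rewrite dF.
  by [].
have lim h N' N'N N'inf hP := qform_limit add (fun k => mfd_c_neq0 k fB add)
  lim0 (N' := N') N'N N'inf (h := h) hP ev0.
(* This form is the sum of the |c_i|^2, which cannot vanish because c_{i0} is nonzero. *)
suff q0 : qform c (fun i l => (cos (gdist (x i) (x l)) == 1)%:R) = 0.
  move: q0; rewrite qform_delta// => /eqP.
  rewrite psumr_eq0 => [|i _]; last by rewrite exprn_ge0.
  move=> /allP /(_ i0 (mem_index_enum _)) /=.
  by rewrite sqrf_eq0 normr_eq0 (negbTE ci0).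
have a1 : - 2^-1 < mfd_alpha R M := mfd_alpha_gt R M.
have b1 : - 2^-1 <= mfd_beta R M := mfd_beta_ge R M.
have bC (b : bool) : (b%:R : R)%:C = b%:R by case: b.
(* Off the sphere beta < alpha, and the limit along the whole of N is the indicator of 1. *)
have [sM|sM] := boolP (is_sphere M); last first.
  have := lim (fun t => (t == 1)%:R) N (fun _ => id) Ninf.
  under eq_fun do under eq_fun do rewrite bC.
  apply=> t t1; apply: cvg_trans (cvg_app _ (cvg_within _)) _.
  by apply: njacobi_cvg t1 => //; exact: mfd_beta_lt.
have [Neven Nodd] := sph sM.
have par e N' : N' `<=` N -> infinite_set N' -> N' `<=` [set k | odd k = e] ->
    qform c (fun i l => (((cos (gdist (x i) (x l)) == 1)%:R +
      (-1) ^+ e * (cos (gdist (x i) (x l)) == -1)%:R : R))%:C) = 0.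
  move=> N'N N'inf N'e.
  apply: (lim (fun t => (t == 1)%:R + (-1) ^+ e * (t == -1)%:R) N') => // t t1.
  by rewrite (mfd_beta_sphere _ sM); apply: njacobi_cvg_parity N'e t1.
have qe := par false _ (@subIsetl _ _ _) Neven (fun k Nk => negbTE Nk.2).
have qo := par true _ (@subIsetl _ _ _) Nodd (fun k Nk => Nk.2).
have two0 : (2 : R[i]) != 0 by rewrite pnatr_eq0.
(* The even and odd limits differ in the sign at cosine -1, so antipodal pairs cancel in their sum,
   which is twice the diagonal form. *)
apply/eqP; rewrite -(mulrI_eq0 _ (mulfI two0)) -qformZ; apply/eqP.
rewrite -[RHS](addr0 0) -[X in _ = X + _]qe -[X in _ = _ + X]qo -qformD.
congr qform; apply/funext => i; apply/funext => l.
rewrite -bC -(rmorph_nat (real_complex R) 2) -rmorphM -rmorphD.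
by congr (_%:C); rewrite expr0 expr1; ring.
Qed.
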